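(* Let $1\le r\le n/2$ and $\nu\in\mathbb{C}$, and let $\hat{\mathcal{D}}_\nu$ be the operator on functions on $Gr_r(\mathbb{R}^n)$ which acts on each irreducible $O(n)$-subspace $\mathcal{H}_m\subset L^2(Gr_r(\mathbb{R}^n))$, $m\in\Lambda_r$, as multiplication by the scalar $$\prod_{j=1}^r\Big(\nu+\tfrac{j+1}{2}-\tfrac{m_j}{2}\Big)\Big(\nu+\tfrac n2-\tfrac{j-1}{2}+\tfrac{m_j}{2}\Big).$$ Then $$\hat{\mathcal{D}}_\nu=\left(-\tfrac14\right)^r\sum_{k=0}^rc_kV_k,\qquad\text{where}\qquad c_k=\prod_{j=k+1}^r[j+2\nu+1]\,[j-(2\nu+n+1)].$$
   Context: $\Lambda_r:=\{m=(m_1,\dots,m_r)\in(2\mathbb{Z})^r\,|\,m_1\ge\dots\ge m_r\ge0\}$. Under $O(n)$, $L^2(Gr_r(\mathbb{R}^n))=\bigoplus_{m\in\Lambda_r}\mathcal{H}_m$ with pairwise non-isomorphic irreducible $\mathcal{H}_m$; here $\mathcal{H}_m$ is the irreducible $O(n)$-subspace whose restriction to $SO(n)$ contains the irreducible representation with highest weight $(m_1,\dots,m_r,0,\dots,0)\in\mathbb{Z}^{\lfloor n/2\rfloor}$ (highest weights of $SO(n)$ being parameterized in the standard way by integer sequences $(m_1,\dots,m_l)$, $l=\lfloor n/2\rfloor$, with $m_1\ge\dots\ge m_l\ge0$ for $n$ odd and $m_1\ge\dots\ge m_{l-1}\ge|m_l|$ for $n$ even). For $r=n/2$ and $m_r\neq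 0$, $\mathcal{H}_m$ is the sum of the two $SO(n)$-irreducible subspaces of highest weights $(m_1,\dots,m_{r-1},\pm m_r)$. For a $2k\times2k$ skew-symmetric matrix $M$ with entries in a possibly non-commutative algebra, $Pf(M)=\frac1{k!}\sum_\sigma sgn(\sigma)M_{\sigma(1)\sigma(2)}\cdots M_{\sigma(2k-1)\sigma(2k)}$, sum over permutations $\sigma$ of $\{1,\dots,2k\}$ with $\sigma(1)<\sigma(2),\dots,\sigma(2k-1)<\sigma(2k)$. $X=(X_{ab})$ is the $n\times n$ matrix with entries $X_{ab}=E_{ab}-E_{ba}\in\mathfrak{o}(n)$, $E_{ab}$ the matrix units; for $I\subset\{1,\dots,n\}$, $X_I$ is the principal submatrix of $X$ with rows and columns in $I$. For $0\le d\le n/2$, $V_d=(-1)^d\sum_{|I|=2d}Pf(X_I)^2\in U(\mathfrak{o}(n))$, $V_0=1$. The $V_d$ are $O(n)$-invariant elements of $U(\mathfrak{o}(n))$ and are identified with the differential operators they induce on functions on $Gr_r(\mathbb{R}^n)$ via the natural action of $O(n)$. Empty products equal $1$. *)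

(* Defs.v *)
From HB Require Import structures.
From mathcomp Require Import all_boot all_order all_algebra fingroup perm ring.
From mathcomp Require Import complex.
From mathcomp Require Import all_classical all_reals all_analysis.

Set Implicit Arguments.
Unset Strict Implicit.
Unset Printing Implicit Defensive.

Import Order.TTheory GRing.Theory Num.Theory.
Import numFieldNormedType.Exports.

Local Open Scope classical_set_scope.
Local Open Scope complex_scope.
Local Open Scope ring_scope.

(* The positions 2i and 2i+1 (counted from 0) among n, for i < k and 2k <= n. *)
Lemma fst_pos_subproof k n (le2k : (k.*2 <= n)%N) (i : 'I_k) : (i.*2 < n)%N.
Proof. by apply: leq_trans le2k; rewrite ltn_double. Qed.

Lemma snd_pos_subproof k n (le2k : (k.*2 <= n)%N) (i : 'I_k) : (i.*2.+1 < n)%N.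
Proof. by apply: leq_trans le2k; rewrite -doubleS leq_double. Qed.

Definition fst_pos k n (le2k : (k.*2 <= n)%N) (i : 'I_k) : 'I_n :=
  Ordinal (fst_pos_subproof le2k i).
Definition snd_pos k n (le2k : (k.*2 <= n)%N) (i : 'I_k) : 'I_n :=
  Ordinal (snd_pos_subproof le2k i).

Lemma half_double_leq n : (n./2.*2 <= n)%N.
Proof. by rewrite -[leqRHS]odd_double_half leq_addl. Qed.

Definition O_ (R : realType) (n : nat) := {g : 'M[R]_n | g *m g^T == 1%:M}.

(* A subspace is represented by the orthogonal projection onto it; the topology
   is the one induced by 'M[R]_n. *)
Definition Gr_set (R : realType) (n r : nat) : set 'M[R]_n :=
  [set P | [/\ P^T = P, P *m P = P & \rank P = r]].
Arguments Gr_set : clear implicits.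
Definition Gr (R : realType) (n r : nat) := set_type (Gr_set R n r).

Section Action.
Variables (R : realType) (n r : nat).
Local Notation G := (O_ R n).
Local Notation Gr := (Gr R n r).

Lemma O_tr_subproof (g : G) : (val g)^T *m (val g)^T^T == 1%:M.
Proof. by rewrite trmxK; apply/eqP; apply: mulmx1C; exact/eqP/(valP g). Qed.

Definition O_inv (g : G) : G := exist _ (val g)^T (O_tr_subproof g).

Lemma Gr_act_subproof (g : G) (P : Gr) :
  val g *m val P *m (val g)^T \in Gr_set R n r.
Proof.
have [sP iP rP] := set_valP P; have gg := eqP (valP g); have tgg := mulmx1C gg.
rewrite inE; split.
- by rewrite !trmx_mul trmxK sP mulmxA.
- by rewrite -!mulmxA (mulmxA _^T (val g)) tgg mul1mx (mulmxA (val P)) iP.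
- have [gu gtu] := mulmx1_unit gg.
  rewrite mxrankMfree; last by rewrite row_free_unit.
  by rewrite -mxrank_tr trmx_mul mxrankMfree ?row_free_unit // mxrank_tr.
Qed.

Definition Gr_act (g : G) (P : Gr) : Gr := SigSub (Gr_act_subproof g P).

(* X_ab = E_ab - E_ba, over any ring. *)
Definition Xmx (K : pzRingType) (a b : 'I_n) : 'M[K]_n :=
  delta_mx a b - delta_mx b a.

(* exp (t X_ab), as X_ab ^ 3 = - X_ab. *)
Definition expX_mx (a b : 'I_n) (t : R) : 'M[R]_n :=
  1%:M + sin t *: Xmx R a b + (1 - cos t) *: (Xmx R a b *m Xmx R a b).

Lemma Xmx3 (a b : 'I_n) :
  Xmx R a b *m Xmx R a b *m Xmx R a b = - Xmx R a b.
Proof.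
have [->|ab] := eqVneq a b; first by rewrite /Xmx subrr !mulmx0 oppr0.
have ba : b != a by rewrite eq_sym.
rewrite /Xmx !(mulmxBl, mulmxBr) !mul_delta_mx_cond !eqxx (eq_sym b a).
rewrite (negbTE ab) !mulr0n !mulr1n !mul0mx !mul_delta_mx !mul_delta_mx_0 //.
by rewrite !(subr0, sub0r) opprB opprK addrC.
Qed.

Lemma expX_subproof (a b : 'I_n) (t : R) :
  expX_mx a b t *m (expX_mx a b t)^T == 1%:M.
Proof.
have XT : (Xmx R a b)^T = - Xmx R a b.
  by rewrite /Xmx linearB /= !trmx_delta opprB.
have X3 := Xmx3 a b.
rewrite /expX_mx; move: (Xmx R a b) XT X3 => X XT X3.
set s := sin t; set c := cos t.
rewrite !linearD !linearZ /= trmx1 trmx_mul XT mulNmx.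
have X31 : X *m (X *m X) = - X by rewrite mulmxA.
have X4 : X *m X *m (X *m X) = - (X *m X) by rewrite mulmxA X3 mulNmx.
rewrite !(mulmxDl, mulmxN, mul1mx, mulmx1, opprK) -!scalemxAl.
rewrite X3 X31 X4 !(scalerDr, scalerN, scalerA).
have -> : s * s = 1 - c * c.
  by rewrite -!expr2 -(cos2Dsin2 t) addrAC subrr add0r.
by apply/eqP/matrixP => i j; rewrite !mxE; ring.
Qed.

Definition expX (a b : 'I_n) (t : R) : G :=
  exist _ (expX_mx a b t) (expX_subproof a b t).

End Action.

Notation fn R n r := (Gr R n r -> R[i]^o).

Section Functions.
Variables (R : realType) (n r : nat).
Local Notation C := R[i].
Local Notation G := (O_ R n).
Local Notation fn := (fn R n r).

Definition O_act (g : G) (f : fn) : fn := fun P => f (Gr_act (O_inv g) P).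

Definition Xop (a b : 'I_n) (f : fn) : fn := fun P =>
  derive1 (fun t : R => complex.Re (O_act (expX a b t) f P) : R) 0 +i*
  derive1 (fun t : R => complex.Im (O_act (expX a b t) f P) : R) 0.

Definition Xword (w : seq ('I_n * 'I_n)) (f : fn) : fn :=
  foldr (fun ab => Xop ab.1 ab.2) f w.

(* The fields induced by the X_ab span every tangent space, so these are the
   C^oo functions. *)
Definition smooth (f : fn) : Prop := forall w : seq ('I_n * 'I_n),
  let h := Xword w f in
  [/\ continuous (fun P => complex.Re (h P) : R),
      continuous (fun P => complex.Im (h P) : R) &
      forall (a b : 'I_n) (P : Gr R n r),
        derivable (fun t : R => complex.Re (O_act (expX a b t) h P) : R) 0 1 /\
        derivable (fun t : R => complex.Im (O_act (expX a b t) h P) : R) 0 1].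

(* Convergence in C^oo(Gr). *)
Definition cvg_smooth (F : nat -> fn) (f : fn) : Prop :=
  smooth f /\ forall (w : seq ('I_n * 'I_n)) (e : R), 0 < e ->
    \forall N \near \oo, forall P : Gr R n r,
      `|Xword w (F N) P - Xword w f P| <= e%:C.

Definition SO : set G := [set g | \det (val g) = 1].

Definition subspace (W : set fn) : Prop :=
  W 0 /\ forall (a : C) (u v : fn), W u -> W v -> W (a *: u + v).

Definition findim (W : set fn) : Prop :=
  exists (N : nat) (b : 'I_N -> fn), forall u, W u ->
    exists c : 'I_N -> C, u = \sum_(i < N) c i *: b i.

Definition invariant (S : set G) (W : set fn) : Prop :=
  forall g u, S g -> W u -> W (O_act g u).

Definition irreducible (S : set G) (W : set fn) : Prop :=
  [/\ subspace W, invariant S W, (exists2 u, W u & u <> 0) &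
      forall W', W' `<=` W -> subspace W' -> invariant S W' ->
        W' = [set 0] \/ W' = W].

(* The action of so(n, C); note Y = \sum_(a < b) Y_ab X_ab for Y^T = - Y. *)
Definition lie_act (Y : 'M[C]_n) (f : fn) : fn :=
  \sum_(a < n) \sum_(b < n | (a < b)%N) Y a b *: Xop a b f.

(* The rotation by angle t in the j-th coordinate plane is exp (i t H_j), so it
   acts on a vector of weight la as exp (i t la_j). *)
Definition Hmx (j : 'I_n./2) : 'M[C]_n :=
  'i *: Xmx C (fst_pos (half_double_leq n) j) (snd_pos (half_double_leq n) j).

Definition positive_root (al : 'I_n./2 -> int) : Prop :=
  [\/ exists i j : 'I_n./2,
        (i < j)%N /\ forall k, al k = (k == i)%:Z - (k == j)%:Z,
      exists i j : 'I_n./2,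
        (i < j)%N /\ forall k, al k = (k == i)%:Z + (k == j)%:Z |
      odd n /\ exists i : 'I_n./2, forall k, al k = (k == i)%:Z].

Definition root_vector (al : 'I_n./2 -> int) (Y : 'M[C]_n) : Prop :=
  Y^T = - Y /\ forall j, Hmx j *m Y - Y *m Hmx j = (al j)%:~R *: Y.

Definition highest_weight_vector (la : 'I_n./2 -> int) (v : fn) : Prop :=
  [/\ v <> 0, (forall j, lie_act (Hmx j) v = (la j)%:~R *: v) &
      forall al Y, positive_root al -> root_vector al Y -> lie_act Y v = 0].

Definition SO_irrep (la : 'I_n./2 -> int) (U : set fn) : Prop :=
  irreducible SO U /\ exists2 v, U v & highest_weight_vector la v.

Definition Lambda (m : 'I_r -> int) : Prop :=
  [/\ forall i, (2 %| m i)%Z, forall i j : 'I_r, (i <= j)%N -> m j <= m i &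
      forall i, 0 <= m i].

(* (m_1, ..., m_r, 0, ..., 0) *)
Definition pad (m : 'I_r -> int) : 'I_n./2 -> int :=
  fun j => oapp m 0 (insub (val j)).

(* The irreducible O(n)-subspaces of L^2(Gr) are finite-dimensional and consist
   of smooth functions, so they can be sought in C^oo(Gr). *)
Definition is_Hm (m : 'I_r -> int) (W : set fn) : Prop :=
  [/\ findim W, W `<=` smooth, irreducible [set: G] W &
      exists2 U, U `<=` W & SO_irrep (pad m) U].

Definition Hm (m : 'I_r -> int) : set fn :=
  [set f | exists2 W, is_Hm m W & W f].

Definition Dhat_scalar (nu : C) (m : 'I_r -> int) : C :=
  \prod_(i < r) let j : C := i.+1%:R in let mj : C := (m i)%:~R in
    (nu + (j + 1) / 2 - mj / 2) * (nu + n%:R / 2 - (j - 1) / 2 + mj / 2).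

(* f = \sum_i u_i in C^oo(Gr), with u_i in H_(m_i). Every f in C^oo(Gr) has such
   an expansion, whose terms are its components in L^2(Gr) = (+)_m H_m. *)
Definition expansion (m : nat -> 'I_r -> int) (u : nat -> fn) (f : fn) : Prop :=
  (forall i, Lambda (m i) /\ Hm (m i) (u i)) /\
  cvg_smooth (fun N => \sum_(i < N) u i) f.

Definition expandable (f : fn) : Prop := exists m u, expansion m u f.

(* g is the image of f under the operator which acts on each H_m as
   multiplication by Dhat_scalar nu m. *)
Definition Dhat (nu : C) (f g : fn) : Prop :=
  exists m u, expansion m u f /\
    cvg_smooth (fun N => \sum_(i < N) Dhat_scalar nu (m i) *: u i) g.

Definition ck (nu : C) (k : nat) : C :=
  \prod_(k.+1 <= j < r.+1)
    ((j%:R + 2 * nu + 1) * (j%:R - (2 * nu + n%:R + 1))).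

End Functions.

(* The Pfaffian of a matrix of operators; the product is composition. *)
Definition Pf (K : fieldType) (V : lmodType K) (k : nat)
    (M : 'I_k.*2 -> 'I_k.*2 -> V -> V) : V -> V := fun v =>
  let p := fst_pos (leqnn k.*2) in let q := snd_pos (leqnn k.*2) in
  (k`!%:R)^-1 *:
    \sum_(s : 'S_k.*2 | [forall i, (s (p i) < s (q i))%N])
      (-1) ^+ s *: (\big[comp/idfun]_(i < k) M (s (p i)) (s (q i))) v.

(* A subset I of cardinality 2d is given by its increasing enumeration. *)
Definition increasing (k n : nat) (I : {ffun 'I_k -> 'I_n}) : bool :=
  [forall i : 'I_k, forall j : 'I_k, (i < j)%N ==> (I i < I j)%N].

Definition Vop (R : realType) (n r d : nat) (f : fn R n r) : fn R n r :=
  (-1) ^+ d *: \sum_(I : {ffun 'I_d.*2 -> 'I_n} | increasing I)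
    let PfX := Pf (fun i j => @Xop R n r (I i) (I j)) in PfX (PfX f).

(* Main.v *)
(* The operators V_k commute with O(n), so on the irreducible space H_m they act
   by the scalar lam_k by which they act on a highest weight vector v.

   In the orthonormal basis each term of Pf(X_I) is a product over disjoint pairs
   of indices, so its factors commute, and Pf(X_I) expands along a row as for
   commuting entries.  Split off the first coordinate plane: X_12 v = - i m_1 v and
   X_1c v = i X_2c v for c > 2.  Then Pf(X_12J) v = - i (m_1 + k - 1) Pf(X_J) v for
   |J| = 2k - 2, and Pf(X_1J)^2 + Pf(X_2J)^2 acts on v as i [Pf(X_1J), Pf(X_2J)],
   which is a sum of products Pf(X_12K) Pf(X_K).  This gives the recursion
     lam_k(n; m_1, m_2, ...) = lam_k(n - 2; m_2, ...)
        + (m_1 + k - 1) (m_1 + n - 1 - k) lam_(k-1)(n - 2; m_2, ...),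
   from which \sum_k c_k lam_k factors by induction on the number of planes.

   The commutation relations of the matrices by which the X_ab act on H_m follow
   from differentiating the Euler angle decomposition of a product of rotations.
   Finally the V_k are differential operators, so they can be applied termwise to
   an expansion which converges in C^oo. *)
Require Import Defs.
From mathcomp Require Import all_boot all_order all_algebra fingroup perm.
From mathcomp Require Import complex zify ring.
From mathcomp Require Import all_classical all_reals all_analysis.

Set Implicit Arguments.
Unset Strict Implicit.
Unset Printing Implicit Defensive.

Import Order.TTheory GRing.Theory Num.Theory.
Import numFieldNormedType.Exports.
Local Open Scope classical_set_scope.
Local Open Scope complex_scope.
Local Open Scope ring_scope.

(** * Pfaffians with noncommuting entries *)

Local Notation fstp := (fst_pos (leqnn _)).
Local Notation sndp := (snd_pos (leqnn _)).

(** The obstacle is that [smooth] provides derivatives only along the one-parameter groups of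
    coordinate rotations, so a bracket of two [Xop] is not directly a fact of calculus. It is
    extracted from identities in the group. The Euler formula expresses a product of two rotations
    by coordinate rotations whose angles are explicit functions of one real variable, so the chain
    rule applies factor by factor. One derivative gives the conjugate of X_bc by a rotation in the
    plane of a, b; a second one gives the bracket. Coordinates on an invariant space are values at
    suitable points, which makes the matrix entries of the action differentiable by the definition
    of [smooth].

    The factorization of the final sum has a simple source. Put z = 2 nu + 1 and F(x) = (x + z)(x -
    z - n). Then c_k is the product of the F(j) for k < j <= r. The eigenvalue is, up to the power
    of -1/4, the product of the F(p - m_p). The coefficient of the recursion is a difference of
    values of F: for the first plane, F(1 - m_1) - F(k) = (m_1 + k - 1)(m_1 + n - 1 - k). *)

Lemma lift_perm_inj n (i j : 'I_n.+1) : injective (@lift_perm n i j).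
Proof.
move=> s t st; apply/permP => x; apply: (@lift_inj _ j).
by rewrite -!(lift_perm_lift i) st.
Qed.

Lemma lift_perm_onto n (i j : 'I_n.+1) (s : 'S_n.+1) :
  s i = j -> exists t, s = lift_perm i j t.
Proof.
move=> si; pose g x := odflt x (unlift j (s (lift i x))).
have gE x : lift j (g x) = s (lift i x).
  rewrite /g; case: unliftP => [y -> //|e].
  by have := neq_lift i x; rewrite -(inj_eq (@perm_inj _ s)) si e eqxx.
have g_inj : injective g.
  by move=> x y e; apply/(@lift_inj _ i)/(@perm_inj _ s); rewrite -!gE e.
exists (perm g_inj); apply/permP => x.
by case: (unliftP i x) => [y|] ->; rewrite ?lift_perm_id ?lift_perm_lift ?permE ?gE.
Qed.

(** Fixing one value of a permutation leaves a permutation of the other indices. In [pf_row0] this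
    is applied twice: to the position of the index 0, then to the value at the position paired with
    it. *)
Lemma big_lift_perm (A : nmodType) n (i j : 'I_n.+1) (F : 'S_n.+1 -> A) :
  \sum_(s : 'S_n.+1 | s i == j) F s = \sum_(s : 'S_n) F (lift_perm i j s).
Proof.
rewrite -(big_imset F (in2W (@lift_perm_inj n i j))) /=; apply: eq_bigl => s.
apply/eqP/imsetP => [/lift_perm_onto[t ->]|[t _ ->]]; first by exists t.
exact: lift_perm_id.
Qed.

Lemma prod_comm_lift (A : pzRingType) n (Y : 'I_n.+1 -> A) (p : 'I_n.+1) :
  (forall q, Y p * Y q = Y q * Y p) ->
  \prod_q Y q = Y p * \prod_q Y (lift p q).
Proof.
elim: n Y p => [|n IH] Y p cY.
  by rewrite big_ord_recl !big_ord0 (ord1 p).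
case: (unliftP ord0 p) cY => [p'|] -> cY.
  rewrite big_ord_recl (IH (fun q => Y (lift ord0 q)) p') //.
  rewrite mulrA -cY -mulrA; congr (_ * _).
  rewrite [RHS]big_ord_recl; congr (Y _ * _); first by apply: val_inj; rewrite /= /bump.
  by apply: eq_bigr => q _; congr (Y _); apply: val_inj; rewrite /= /bump; lia.
by rewrite big_ord_recl.
Qed.

Section Antisym.
Variables (C : numFieldType) (A : algType C) (T : eqType) (X : T -> T -> A).

Definition xprod k (f : 'I_k.*2 -> T) : A :=
  \prod_(p < k) X (f (fstp p)) (f (sndp p)).

(* [pf] runs over all permutations: it is [2 ^ k * k`!] times the Pfaffian. *)
Definition pf k (f : 'I_k.*2 -> T) : A :=
  \sum_(s : 'S_k.*2) (-1) ^+ s * xprod (f \o s).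

Lemma eq_xprod k (f g : 'I_k.*2 -> T) : f =1 g -> xprod f = xprod g.
Proof. by move=> fg; apply: eq_bigr => p _; rewrite !fg. Qed.

Lemma eq_pf k (f g : 'I_k.*2 -> T) : f =1 g -> pf f = pf g.
Proof.
by move=> fg; apply: eq_bigr => s _; congr (_ * _); apply: eq_xprod => x /=; rewrite fg.
Qed.

Lemma pf_perm k (f : 'I_k.*2 -> T) (t : 'S_k.*2) :
  pf (f \o t) = (-1) ^+ t * pf f.
Proof.
rewrite /pf mulr_sumr [RHS](reindex_inj (mulIg t)) /=.
apply: eq_bigr => s _; rewrite odd_permM mulrA -signr_addb addbC addbK.
by congr (_ * _); apply: eq_xprod => x /=; rewrite permM.
Qed.

Lemma alg_2torsion (a : A) : a = - a -> a = 0.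
Proof.
move=> /eqP; rewrite -subr_eq0 opprK -mulr2n -scaler_nat scaler_eq0.
by rewrite pnatr_eq0 => /eqP.
Qed.

Lemma pf_eq0 k (f : 'I_k.*2 -> T) x y : x != y -> f x = f y -> pf f = 0.
Proof.
move=> xy fxy; apply: alg_2torsion.
have := pf_perm f (tperm x y); rewrite odd_tperm xy expr1 mulN1r => <-.
by apply: eq_pf => z /=; case: tpermP => // ->.
Qed.

Definition upd_at (I : eqType) (f : I -> T) i a := fun j => if j == i then a else f j.

Definition shift2 k (x : 'I_k.*2) : 'I_k.+1.*2 := lift ord0 (lift ord0 x).

Lemma xprodS k (f : 'I_k.+1.*2 -> T) :
  xprod f = X (f ord0) (f (lift ord0 ord0)) * xprod (f \o @shift2 k).
Proof.
rewrite /xprod big_ord_recl; congr (X (f _) (f _) * _); do ?exact: val_inj.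
by apply: eq_bigr => p _ /=; congr (X (f _) (f _)); apply: val_inj => /=;
  rewrite /bump /=; lia.
Qed.

(** Meant for [g] the matrix of a coordinate reflection, with [e] the sign by which it multiplies
    each coordinate. *)
Lemma xprod_conj (g : A) (e : T -> C) k (f : 'I_k.*2 -> T) :
  (forall a b, g * X a b = (e a * e b) *: (X a b * g)) ->
  g * xprod f = (\prod_t e (f t)) *: (xprod f * g).
Proof.
move=> gX; elim: k f => [|k IH] f.
  by rewrite /xprod !big_ord0 mulr1 mul1r scale1r.
rewrite xprodS mulrA gX -scalerAl -(mulrA _ g) IH -scalerAr scalerA (mulrA (X _ _)).
by rewrite !big_ord_recl mulrA.
Qed.

Section Derivation.
Variables (Z : A) (a b : T).
Hypothesis ZX : forall c d, Z * X c d - X c d * Z =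
  (c == b)%:R * X a d - (c == a)%:R * X b d
  + (d == b)%:R * X c a - (d == a)%:R * X c b.

(** The bracket with [Z] is a derivation. By [ZX] it acts on the indices one at a time, sending b to
    a and a to minus b, so the Leibniz rule gives one term for each position. *)
Lemma xprod_der k (f : 'I_k.*2 -> T) :
  Z * xprod f - xprod f * Z = \sum_t ((f t == b)%:R * xprod (upd_at f t a) -
     (f t == a)%:R * xprod (upd_at f t b)).
Proof.
elim: k f => [|k IH] f; first by rewrite /xprod !big_ord0 mulr1 mul1r subrr.
rewrite big_ord_recl big_ord_recl.
set f0 := ord0 : 'I_k.+1.*2; set f1 := lift _ _ : 'I_k.+1.*2.
have u0 e : xprod (upd_at f f0 e) = X e (f f1) * xprod (f \o @shift2 k).
  by rewrite xprodS; congr (_ * _); apply: eq_xprod.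
have u1 e : xprod (upd_at f f1 e) = X (f f0) e * xprod (f \o @shift2 k).
  by rewrite xprodS; congr (_ * _); apply: eq_xprod.
have -> : \sum_(i < k.*2) ((f (lift ord0 (lift ord0 i)) == b)%:R *
      xprod (upd_at f (lift ord0 (lift ord0 i)) a) -
    (f (lift ord0 (lift ord0 i)) == a)%:R *
      xprod (upd_at f (lift ord0 (lift ord0 i)) b)) =
   X (f f0) (f f1) * (Z * xprod (f \o @shift2 k) - xprod (f \o @shift2 k) * Z).
  rewrite IH mulr_sumr; apply: eq_bigr => t _.
  rewrite !mulr_natl mulrBr !mulrnAr.
  by congr (_ *+ _ - _ *+ _); rewrite xprodS; congr (_ * _);
     apply: eq_xprod => x /=; rewrite /upd_at /= !(inj_eq lift_inj).
rewrite !u0 !u1 xprodS -/f0 -/f1.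
move: (xprod _) => w; set x := X (f f0) (f f1).
rewrite addrA !mulrBr !mulrA.
have -> : Z * x * w - x * w * Z = (Z * x - x * Z) * w + (x * Z * w - x * w * Z).
  by rewrite mulrBl addrA addrNK.
by rewrite ZX !mulrDl !mulNr !addrA.
Qed.

Lemma pf_der k (f : 'I_k.*2 -> T) :
  Z * pf f - pf f * Z = \sum_t ((f t == b)%:R * pf (upd_at f t a) -
     (f t == a)%:R * pf (upd_at f t b)).
Proof.
transitivity (\sum_(s : 'S_k.*2) \sum_(t < k.*2) (-1) ^+ s *
    ((f (s t) == b)%:R * xprod (upd_at f (s t) a \o s) -
     (f (s t) == a)%:R * xprod (upd_at f (s t) b \o s))).
  rewrite /pf mulr_sumr mulr_suml -sumrB; apply: eq_bigr => s _.
  rewrite mulrA commr_sign -!mulrA -mulrBr xprod_der mulr_sumr.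
  apply: eq_bigr => t _; congr (_ * (_ * _ - _ * _));
    by apply: eq_xprod => x /=; rewrite /upd_at /= (inj_eq perm_inj).
rewrite exchange_big /=.
(* For each permutation [s] the sum over positions in the word is reindexed by [s], which turns it
   into a sum over positions in [f]. *)
transitivity (\sum_(t < k.*2) \sum_(s : 'S_k.*2) (-1) ^+ s *
    ((f t == b)%:R * xprod (upd_at f t a \o s) -
     (f t == a)%:R * xprod (upd_at f t b \o s))).
  rewrite exchange_big [RHS]exchange_big /=; apply: eq_bigr => s _.
  by rewrite [RHS](reindex_inj (@perm_inj _ s)).
apply: eq_bigr => t _; rewrite /pf !mulr_sumr -sumrB; apply: eq_bigr => s _.
by rewrite mulrBr !mulrA !(mulr_natr, mulr_natl) !mulrnAl.
Qed.

End Derivation.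

Section Expansion.
Hypothesis XN : forall a b, X a b = - X b a.

Lemma fst_pos_lift k (p : 'I_k.+1) (u : 'I_k.*2.+1) (q : 'I_k) :
  u = p.*2 :> nat ->
  [/\ fstp (lift p q) = lift (fstp p) (lift u (fstp q)),
      sndp (lift p q) = lift (fstp p) (lift u (sndp q)),
      fstp (lift p q) = lift (sndp p) (lift u (fstp q)) &
      sndp (lift p q) = lift (sndp p) (lift u (sndp q))].
Proof.
by move=> up; split; apply: val_inj; rewrite /= !up /bump; case: ltngtP => /=; lia.
Qed.

(* Factors with disjoint index pairs commute, so in each term the factor that
   contains the index 0 can be brought to the front. *)
Lemma pf_row0 k (f : 'I_k.+1.*2 -> T) :
  (forall c d x y, uniq [:: c; d; x; y] ->
    X (f c) (f d) * X (f x) (f y) = X (f x) (f y) * X (f c) (f d)) ->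
  pf f = k.+1.*2%:R * \sum_(t < k.*2.+1)
    (-1) ^+ t * X (f ord0) (f (lift ord0 t)) * pf (f \o lift ord0 \o lift t).
Proof.
move=> cX.
set E := \sum_(t < _) _.
(* Each of the [k.+1.*2] positions [u] at which the index 0 can stand contributes the same sum. *)
suff H u : \sum_(s : 'S_k.+1.*2 | s u == ord0) (-1) ^+ s * xprod (f \o s) = E.
  transitivity (\sum_u \sum_(s : 'S_k.+1.*2 | s u == ord0) (-1) ^+ s * xprod (f \o s)).
    rewrite (exchange_big_dep predT) //=; apply: eq_bigr => s _.
    rewrite (big_pred1 (s^-1%g ord0)) // => u /=.
    by rewrite -[in RHS](inj_eq (@perm_inj _ s)) permKV.
  by under eq_bigr do rewrite H; rewrite sumr_const card_ord mulr_natl.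
have up : (u./2 < k.+1)%N by have := ltn_ord u; lia.
(* [p] is the pair that contains the position [u]. Once [u] is removed, the other position of this
   pair has number [p.*2], whichever of the two [u] was. *)
pose p : 'I_k.+1 := Ordinal up.
have u'p : (p.*2 < k.*2.+1)%N by rewrite /=; lia.
pose u' : 'I_k.*2.+1 := Ordinal u'p.
rewrite big_lift_perm.
transitivity (\sum_(t < k.*2.+1) \sum_(s : 'S_k.*2)
  (-1) ^+ lift_perm u ord0 (lift_perm u' t s) *
  @xprod k.+1 (f \o lift_perm u ord0 (lift_perm u' t s))).
  rewrite -[RHS](eq_bigr _ (fun t _ => big_lift_perm u' t
    (fun s => (-1) ^+ lift_perm u ord0 s * @xprod k.+1 (f \o lift_perm u ord0 s)))).
  rewrite (exchange_big_dep predT) //=; apply: eq_bigr => s _.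
  by rewrite (big_pred1 (s u')) // => t /=; rewrite eq_sym.
apply: eq_bigr => t _; rewrite /pf mulr_sumr; apply: eq_bigr => s _.
rewrite !odd_lift_perm; set S := lift_perm _ _ _.
have Hlift q : S (lift u (lift u' q)) = lift ord0 (lift t (s q)).
  by rewrite /S !lift_perm_lift.
have Su : S u = ord0 by rewrite /S lift_perm_id.
have Su' : S (lift u u') = lift ord0 t by rewrite /S lift_perm_lift lift_perm_id.
rewrite {1}/xprod (prod_comm_lift (p := p)); last first.
  move=> q; case: (unliftP p q) => [q' ->|-> //]; apply: cX.
  rewrite /= !inE !(inj_eq perm_inj) -!val_eqE /= /bump; lia.
have up2 : u = p.*2 :> nat \/ u = p.*2.+1 :> nat by rewrite /=; lia.
have -> : \prod_(q < k) X ((f \o S) (fstp (lift p q))) ((f \o S) (sndp (lift p q))) =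
   xprod (f \o lift ord0 \o lift t \o s).
  apply: eq_bigr => q _ /=; have [|e1 e2 e3 e4] := @fst_pos_lift _ p u' q; first by [].
  case: up2 => up2.
    have eu : u = fstp p by apply: val_inj.
    by rewrite e1 ?e2 // -eu !Hlift.
  have eu : u = sndp p by apply: val_inj.
  by rewrite e3 ?e4 // -eu !Hlift.
rewrite !mulrA; congr (_ * _).
case: up2 => up2.
  have <- : u = fstp p by apply: val_inj.
  have <- : lift u u' = sndp p by apply: val_inj; rewrite /= up2 /bump; lia.
  rewrite /= Su Su' up2 !odd_double /= signr_addb.
  by rewrite signr_odd -!mulrA commr_sign.
(* Here the index 0 stands second in its pair: the sign of the odd position [u] cancels the one that
   comes from [XN]. *)
have <- : u = sndp p by apply: val_inj.
have <- : lift u u' = fstp p by apply: val_inj; rewrite /= up2 /bump; lia.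
rewrite /= Su Su' up2 /= !odd_double /= signrN (signr_addb _ (odd t)).
by rewrite XN mulNr mulrN opprK signr_odd -!mulrA commr_sign.
Qed.

Lemma xprod_flip k (f : 'I_k.*2 -> T) (p : 'I_k) :
  xprod (f \o tperm (fstp p) (sndp p)) = - xprod f.
Proof.
pose Y q := X (f (fstp q)) (f (sndp q)).
have -> : xprod (f \o tperm (fstp p) (sndp p)) = \prod_q ((-1) ^+ (q == p) * Y q).
  apply: eq_bigr => q _ /=; have [->|qp] := eqVneq.
    by rewrite tpermL tpermR XN mulN1r.
  have qp' : (q == p :> nat) = false by apply/negbTE.
  by rewrite !tpermD ?mul1r // -val_eqE /=; move: qp'; lia.
rewrite -[xprod f]/(\prod_q Y q) /index_enum.
rewrite -!enumT; move: (enum_uniq 'I_k) (mem_enum 'I_k p).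
move: (enum 'I_k) => r; elim: r => //= q r IH /andP[qr ur].
rewrite !big_cons inE eq_sym; have [eqp _|qp /= pr] := eqVneq q p.
  rewrite expr1 mulN1r mulNr; congr (- (_ * _)).
  rewrite !big_seq; apply: eq_bigr => i ir; rewrite (_ : i == p = false) ?mul1r //.
  by apply: contraNF qr => /eqP ip; rewrite eqp -ip.
by rewrite mul1r IH // mulrN.
Qed.

(** This links [pf] with the sum in [Pf]. The order condition is imposed on one pair after another.
    Exchanging the two entries of a pair changes the sign of the permutation and of the product, so
    both orders contribute equally and each condition halves the sum. *)
Lemma pf_restricted k (f : 'I_k.*2 -> T) :
  pf f = (2 ^ k)%:R * \sum_(s : 'S_k.*2 | [forall i, (s (fstp i) < s (sndp i))%N])
    (-1) ^+ s * xprod (f \o s).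
Proof.
pose B j (s : 'S_k.*2) := [forall i : 'I_k, (i < j)%N ==> (s (fstp i) < s (sndp i))%N].
have H j : (j <= k)%N -> pf f = (2 ^ j)%:R * \sum_(s | B j s) (-1) ^+ s * xprod (f \o s).
  elim: j => [|j IH] jk.
    by rewrite mul1r; apply: eq_bigl => s; apply/esym/forallP.
  rewrite (IH (ltnW jk)) expnSr natrM -mulrA; congr (_ * _).
  pose p : 'I_k := Ordinal jk.
  have BS s : B j.+1 s = B j s && (s (fstp p) < s (sndp p))%N.
    apply/forallP/andP => [Bs|[/forallP Bs sp] i].
      split; last by have := Bs p; rewrite /= ltnSn.
      by apply/forallP => i; apply/implyP => ij; have := Bs i; rewrite ltnW.
    rewrite ltnS leq_eqVlt; case: eqVneq => [ij|_] /=; last exact: Bs.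
    by rewrite (_ : i = p) //; apply: val_inj.
  rewrite (bigID (fun s : 'S__ => (s (fstp p) < s (sndp p))%N)) /=.
  rewrite -(eq_bigl _ _ BS) mulr_natl mulr2n; congr (_ + _).
  rewrite (reindex_inj (mulgI (tperm (fstp p) (sndp p)))) /=.
  apply: eq_big => [s|s _]; last first.
    rewrite odd_mul_tperm (_ : fstp p != sndp p) ?signrN; last by rewrite -val_eqE /=; lia.
    rewrite -[xprod (f \o s)]opprK -(xprod_flip _ p) mulNr -mulrN; congr (_ * - _).
    by apply: eq_xprod => x /=; rewrite permM.
  rewrite BS !permM tpermL tpermR -leqNgt [in RHS]ltn_neqAle.
  rewrite (inj_eq val_inj) (inj_eq perm_inj) (_ : fstp p != sndp p) /=; last first.
    by rewrite -val_eqE /=; lia.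
  congr (_ && _); apply: eq_forallb => i; case: (ltnP i j) => //= ij.
  by rewrite !permM !tpermD // -val_eqE /=; lia.
rewrite (H k) //; congr (_ * _); apply: eq_bigl => s; apply: eq_forallb => i.
by rewrite ltn_ord.
Qed.

End Expansion.

(* The Pfaffian of the principal submatrix with rows and columns [s], when
   [size s = k.*2]. *)
Definition Pfs (x0 : T) k (s : seq T) : A :=
  (2 ^ k * k`!)%:R^-1 *: pf (fun i : 'I_k.*2 => nth x0 s i).

End Antisym.

Section Pfaffian.
Variables (C : numFieldType) (A : algType C) (T : eqType) (X : T -> T -> A) (x0 : T).
Hypothesis XX : forall a b c d, X a b * X c d - X c d * X a b =
  (c == b)%:R * X a d - (c == a)%:R * X b d
  + (d == b)%:R * X c a - (d == a)%:R * X c b.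
Hypothesis XN : forall a b, X a b = - X b a.

Local Notation P := (Pfs X x0).

Lemma Pfs_swap k s1 s2 a b : size (s1 ++ a :: b :: s2) = k.*2 ->
  P k (s1 ++ a :: b :: s2) = - P k (s1 ++ b :: a :: s2).
Proof.
move=> ss; rewrite /Pfs -scalerN; congr (_ *: _).
have l1 : (size s1 < k.*2)%N by rewrite -ss size_cat /=; lia.
have l2 : ((size s1).+1 < k.*2)%N by rewrite -ss size_cat /=; lia.
have ne : Ordinal l1 != Ordinal l2 by rewrite -val_eqE /=; lia.
rewrite -[RHS]mulN1r; have := odd_tperm (Ordinal l1) (Ordinal l2).
rewrite ne => et; rewrite -[X in X * _]expr1 -[1%N]/(nat_of_bool true) -et -pf_perm.
apply: eq_pf => x /=; case: tpermP => [->|->|/eqP n1 /eqP n2] /=.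
- by rewrite !nth_cat ltnn ltnNge leqnSn /= subnn subSn ?subnn.
- by rewrite !nth_cat ltnn ltnNge leqnSn /= subnn subSn ?subnn.
rewrite !nth_cat; case: ltnP => // le.
move: n1 n2; rewrite -!val_eqE /= => n1 n2.
have -> : (x - size s1 = (x - size s1).-2.+2)%N by lia.
by [].
Qed.

Lemma Pfs_move k s1 b s2 : size (s1 ++ b :: s2) = k.*2 ->
  P k (s1 ++ b :: s2) = (-1) ^+ size s1 * P k (b :: s1 ++ s2).
Proof.
elim/last_ind: s1 s2 => [|s1 a IH] s2 ss; first by rewrite mul1r.
rewrite cat_rcons Pfs_swap; last by rewrite -cat_rcons.
rewrite IH; last by rewrite -ss cat_rcons !size_cat.
by rewrite size_rcons cat_rcons exprS mulN1r mulNr.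
Qed.

Lemma Pfs_dup k s : size s = k.*2 -> ~~ uniq s -> P k s = 0.
Proof.
move=> ss /(uniqPn x0)[i [j [ij js e]]]; rewrite /Pfs.
have jk : (j < k.*2)%N by rewrite -ss.
have ik : (i < k.*2)%N by apply: ltn_trans jk.
rewrite (@pf_eq0 _ _ _ X _ _ (Ordinal ik) (Ordinal jk)) ?scaler0 //.
by rewrite -val_eqE /= neq_ltn ij.
Qed.

Lemma Pfs_der k s a b : size s = k.*2 ->
  X a b * P k s - P k s * X a b =
  \sum_(t < k.*2) ((nth x0 s t == b)%:R * P k (set_nth x0 s t a) -
                   (nth x0 s t == a)%:R * P k (set_nth x0 s t b)).
Proof.
move=> ss; rewrite /Pfs -scalerAr -scalerAl -scalerBr (pf_der (XX a b)) scaler_sumr.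
apply: eq_bigr => t _; rewrite scalerBr -!scalerAr.
by congr (_ *: (_ * _) - _ *: (_ * _)); apply: eq_pf => x; rewrite nth_set_nth /upd_at /=.
Qed.

Lemma Pfs_comm0 k s a b : size s = k.*2 -> a \notin s -> b \notin s ->
  X a b * P k s = P k s * X a b.
Proof.
move=> ss ns nb; apply/eqP; rewrite -subr_eq0 Pfs_der // big1 // => t _.
have ts : nth x0 s t \in s by rewrite mem_nth // ss.
have -> : (nth x0 s t == a) = false by apply: contraNF ns => /eqP <-.
have -> : (nth x0 s t == b) = false by apply: contraNF nb => /eqP <-.
by rewrite !mul0r subr0.
Qed.

Lemma X_diag a : X a a = 0.
Proof. exact: (@alg_2torsion _ _ _ (XN a a)). Qed.

Lemma set_nth_dup s t a : (t < size s)%N -> a \in s -> nth x0 s t != a ->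
  ~~ uniq (set_nth x0 s t a).
Proof.
move=> ts a_s ta; apply/(uniqPn x0).
have is_ : (index a s < size s)%N by rewrite index_mem.
have it : index a s != t by apply: contraNneq ta => <-; rewrite nth_index.
have e : nth x0 (set_nth x0 s t a) (index a s) = nth x0 (set_nth x0 s t a) t.
  by rewrite !nth_set_nth /= eqxx (negbTE it) nth_index.
have sz : size (set_nth x0 s t a) = size s by rewrite size_set_nth; lia.
by move: it; rewrite neq_ltn => /orP[it|it];
  [exists (index a s), t | exists t, (index a s)]; split; rewrite ?sz.
Qed.

(** Putting [a] in place of [b], or [b] in place of [a], duplicates an index, so every term of
    [Pfs_der] vanishes. *)
Lemma Pfs_comm2 k s a b : size s = k.*2 -> a \in s -> b \in s ->
  X a b * P k s = P k s * X a b.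
Proof.
move=> ss sa sb; have [<-|ab] := eqVneq a b; first by rewrite X_diag mul0r mulr0.
apply/eqP; rewrite -subr_eq0 Pfs_der // big1 // => t _.
have ts : (t < size s)%N by rewrite ss.
have Z c d : c != d -> c \in s -> (nth x0 s t == d)%:R * P k (set_nth x0 s t c) = 0.
  move=> cd cs; have [td|] := eqVneq; last by rewrite mul0r.
  rewrite Pfs_dup ?mulr0 //; first by rewrite size_set_nth; lia.
  by rewrite set_nth_dup // td eq_sym.
by rewrite !Z ?subr0 // eq_sym.
Qed.

Lemma Pfs_comm1 k s1 s2 a b : size (s1 ++ b :: s2) = k.*2 ->
  uniq (s1 ++ b :: s2) -> a \notin s1 ++ b :: s2 ->
  X a b * P k (s1 ++ b :: s2) - P k (s1 ++ b :: s2) * X a b = P k (s1 ++ a :: s2).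
Proof.
move=> ss us na; rewrite Pfs_der //.
have l1 : (size s1 < k.*2)%N by rewrite -ss size_cat /=; lia.
have na' t : (t < k.*2)%N -> (nth x0 (s1 ++ b :: s2) t == a) = false.
  by move=> tk; apply: contraNF na => /eqP <-; rewrite mem_nth // ss.
have nb : nth x0 (s1 ++ b :: s2) (size s1) = b by rewrite nth_cat ltnn subnn.
rewrite (bigD1 (Ordinal l1)) //= na' // nb eqxx mul1r mul0r subr0 big1 => [|t tl].
  by rewrite addr0; congr (P _ _); elim: s1 {ss us na l1 na' nb} => //= x s1 ->.
rewrite na' // mul0r subr0; case: eqVneq => e; last by rewrite mul0r.
move: tl; rewrite -val_eqE /= -(nth_uniq x0 _ _ us) ?ss // nb e eqxx.
by [].
Qed.

Definition del_nth (t : nat) (s : seq T) := take t s ++ drop t.+1 s.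

Lemma size_del_nth t s : (t < size s)%N -> size (del_nth t s) = (size s).-1.
Proof. by move=> ts; rewrite size_cat size_takel ?size_drop; lia. Qed.

Lemma nth_del_nth t s i : (t < size s)%N -> nth x0 (del_nth t s) i = nth x0 s (bump t i).
Proof.
move=> ts; rewrite nth_cat size_takel; last lia.
case: ltnP => it; first by rewrite nth_take // /bump leqNgt it.
by rewrite nth_drop /bump it; congr nth; lia.
Qed.

Lemma del_nthE t s : (t < size s)%N -> s = take t s ++ nth x0 s t :: drop t.+1 s.
Proof. by move=> ts; rewrite -drop_nth // cat_take_drop. Qed.

Lemma Pfs_row0 k a s : size s = k.*2.+1 -> uniq (a :: s) ->
  P k.+1 (a :: s) = \sum_(t < k.*2.+1) (-1) ^+ t * X a (nth x0 s t) * P k (del_nth t s).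
Proof.
move=> ss us; rewrite /Pfs (pf_row0 XN); last first.
  move=> c d x y u4; apply/eqP; rewrite -subr_eq0 XX.
  have sz (z : 'I_k.+1.*2) : (z < size (a :: s))%N by rewrite /= ss.
  rewrite !(nth_uniq x0 (sz _) (sz _) us).
  move: u4; rewrite /= !inE !negb_or -!val_eqE /= => u4.
  have [-> -> -> ->] : [/\ (x == c :> nat) = false, (x == d :> nat) = false,
     (y == c :> nat) = false & (y == d :> nat) = false] by split; lia.
  by rewrite !mul0r !subr0 addr0.
set S := \sum_(t < _) _.
have -> : k.+1.*2%:R * S = k.+1.*2%:R *: S by rewrite scaler_nat mulr_natl.
rewrite scalerA scaler_sumr; apply: eq_bigr => t _.
rewrite -!scalerAr; congr (_ *: (_ * _)).
  have n0 : k.+1%:R != 0 :> C by rewrite pnatr_eq0.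
  have n1 : k`!%:R != 0 :> C by rewrite pnatr_eq0 -lt0n fact_gt0.
  have n2 : 2%:R != 0 :> C by rewrite pnatr_eq0.
  have n3 : (2 ^+ k) != 0 :> C by rewrite expf_neq0.
  rewrite -muln2 expnS factS !natrM !natrX; field.
  by rewrite nat1r n0 n1 n3.
apply: eq_pf => x; rewrite nth_del_nth ?ss //=.
Qed.

Lemma comm_Pfs k s (Y : A) : size s = k.*2 ->
  {in s &, forall c d, Y * X c d = X c d * Y} -> Y * P k s = P k s * Y.
Proof.
move=> ss cY; rewrite /Pfs -scalerAl -scalerAr; congr (_ *: _).
rewrite /pf mulr_sumr mulr_suml; apply: eq_bigr => t _.
rewrite mulrA commr_sign -!mulrA; congr (_ * _).
apply: (big_ind (fun x => Y * x = x * Y)) => [|x y ex ey|p _ /=].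
- by rewrite mulr1 mul1r.
- by rewrite mulrA ex -!mulrA ey.
- by apply: cY; rewrite mem_nth // ss.
Qed.

Lemma Pfs_conj (g : A) (e : T -> C) k s :
  (forall a b, g * X a b = (e a * e b) *: (X a b * g)) ->
  g * P k s = (\prod_(t < k.*2) e (nth x0 s t)) *: (P k s * g).
Proof.
move=> gX; rewrite /Pfs -scalerAr -scalerAl scalerA mulrC -scalerA; congr (_ *: _).
rewrite /pf mulr_sumr mulr_suml scaler_sumr; apply: eq_bigr => t _.
rewrite mulrA commr_sign -!mulrA (xprod_conj _ gX) /= [RHS]scalerAr; congr (_ * (_ *: _)).
by rewrite [RHS](reindex_inj (@perm_inj _ t)).
Qed.

(** * Sums of squares over subsets of the indices *)

Fixpoint sublists k (l : seq T) : seq (seq T) :=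
  match l, k with
  | [::], 0 => [:: [::]]
  | [::], _.+1 => [::]
  | _ :: l', 0 => sublists 0 l'
  | a :: l', k'.+1 => [seq a :: s | s <- sublists k' l'] ++ sublists k l'
  end.

Lemma mem_sublists k l s : (s \in sublists k l) = subseq s l && (size s == k).
Proof.
elim: l k s => [|a l IH] [|k] s /=.
- by rewrite inE; case: s.
- by case: s.
- by rewrite IH; case: s => [|b s]; rewrite ?andbF // sub0seq.
rewrite mem_cat IH; case: s => [|b s] /=; first by rewrite sub0seq andbF orbF;
  apply/mapP => -[].
have -> : (b :: s \in [seq a :: s | s <- sublists k l]) = (b == a) && (s \in sublists k l).
  apply/mapP/andP => [[s' s'l [-> ->]]|[/eqP -> sl]]; first by rewrite eqxx.
  by exists s.
rewrite IH; case: eqVneq => //= _; rewrite eqSS; case: (size s == k); rewrite ?andbF // !andbT.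
by apply/orP/idP => [[//|]|->]; [exact: cons_subseq | left].
Qed.

Lemma sum_sublists_cons k a l (G : seq T -> A) :
  \sum_(s <- sublists k.+1 (a :: l)) G s =
  \sum_(s <- sublists k l) G (a :: s) + \sum_(s <- sublists k.+1 l) G s.
Proof. by rewrite /= big_cat big_map. Qed.

(** Double counting: a sublist of size [k] arises by deletion once for each of the [size l - k]
    entries outside it. *)
Lemma sum_sublists_del k l (G : seq T -> A) :
  \sum_(s <- sublists k.+1 l) \sum_(t < k.+1) G (del_nth t s) =
  ((size l)%:R - k%:R) *: \sum_(s <- sublists k l) G s.
Proof.
elim: l k G => [|a l IH] k G.
  by rewrite big_nil; case: k => [|k]; rewrite /= ?subrr ?scale0r // big_nil scaler0.
rewrite sum_sublists_cons IH.
have -> : \sum_(s <- sublists k l) \sum_(t < k.+1) G (del_nth t (a :: s)) =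
    \sum_(s <- sublists k l) G s + \sum_(s <- sublists k l) \sum_(t < k) G (a :: del_nth t s).
  rewrite -big_split; apply: eq_bigr => s _; rewrite big_ord_recl /del_nth /= drop0.
  by congr (_ + _).
case: k => [|k].
  rewrite [X in _ + X + _]big1 ?addr0; last by move=> s _; rewrite big_ord0.
  rewrite !subr0 /= -[X in X + _]scale1r -scalerDl nat1r.
  by congr (_ *: _).
rewrite (IH k (fun s => G (a :: s))) sum_sublists_cons addrAC scalerDr addrC.
rewrite -[X in X + _ *: _]scale1r -scalerDl /= -!natr1.
by congr (_ *: _ + _ *: _); ring.
Qed.

Definition sum_Pf2 k l := \sum_(s <- sublists k.*2 l) P k s * P k s.

(** Conjugation multiplies each Pfaffian by a product of signs, which disappears in the square. *)
Lemma sum_Pf2_conj (g : A) (e : T -> C) k l :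
  (forall a b, g * X a b = (e a * e b) *: (X a b * g)) -> (forall a, e a ^+ 2 = 1) ->
  g * sum_Pf2 k l = sum_Pf2 k l * g.
Proof.
move=> gX e2; rewrite /sum_Pf2 mulr_sumr mulr_suml; apply: eq_bigr => s _.
have h := Pfs_conj k s gX; set c := \prod_(t < _) _ in h.
rewrite mulrA h -scalerAl -(mulrA _ g) h -(scalerAr c) scalerA mulrA.
by rewrite -expr2 -prodrXl big1 ?scale1r // => t _.
Qed.

Lemma Pfs0 : P 0 [::] = 1.
Proof.
rewrite /Pfs /pf (big_pred1 1%g); last first.
  by move=> s /=; apply/esym/eqP/permP => -[].
by rewrite odd_perm1 mul1r /xprod big_ord0 mul1n invr1 scale1r.
Qed.

Lemma sublists0 l : sublists 0 l = [:: [::]].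
Proof. by elim: l. Qed.

Lemma sum_Pf2_0 l : sum_Pf2 0 l = 1.
Proof. by rewrite /sum_Pf2 sublists0 big_seq1 Pfs0 mulr1. Qed.

Lemma uniq_mid s1 (a : T) s2 :
  uniq (s1 ++ a :: s2) = (a \notin s1 ++ s2) && uniq (s1 ++ s2).
Proof. by rewrite -cat1s uniq_catCA. Qed.

(* For neighbours [a], [b] in the list, exchanging them keeps sublists sorted, so
   no signs appear. *)
Lemma sum_Pf2_comm k a b l1 l2 : uniq (l1 ++ a :: b :: l2) ->
  X a b * sum_Pf2 k (l1 ++ a :: b :: l2) = sum_Pf2 k (l1 ++ a :: b :: l2) * X a b.
Proof.
(* [pre] collects the indices already chosen from [l1], and [j] is the number of indices still to be
   chosen. *)
suff H (pre : seq T) j : uniq (pre ++ l1 ++ a :: b :: l2) -> (size pre + j)%N = k.*2 ->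
    let G := \sum_(s <- sublists j (l1 ++ a :: b :: l2)) P k (pre ++ s) * P k (pre ++ s) in
    X a b * G = G * X a b.
  by move=> u; exact: (H [::]).
elim: l1 pre j => [|c l1 IH] pre j; last first.
  case: j => [|j] u sj; first by move=> G; rewrite /G /= sublists0 -(sublists0 (l1 ++ a :: b :: l2));
    apply: IH => //; apply: subseq_uniq u; rewrite subseq_cat2l subseq_cons.
  rewrite cat_cons sum_sublists_cons => G; rewrite /G mulrDr mulrDl; congr (_ + _).
    have -> : \sum_(s <- sublists j (l1 ++ a :: b :: l2)) P k (pre ++ c :: s) * P k (pre ++ c :: s)
      = \sum_(s <- sublists j (l1 ++ a :: b :: l2)) P k (rcons pre c ++ s) * P k (rcons pre c ++ s).
      by apply: eq_bigr => s _; rewrite cat_rcons.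
    by apply: IH; rewrite ?cat_rcons // size_rcons addSnnS.
  by apply: IH => //; apply: subseq_uniq u; rewrite subseq_cat2l subseq_cons.
rewrite cat0s => u sj.
have C0 s : subseq s l2 -> (size pre + size s)%N = k.*2 ->
    X a b * (P k (pre ++ s) * P k (pre ++ s)) = (P k (pre ++ s) * P k (pre ++ s)) * X a b.
  move=> sl sk; have ss : size (pre ++ s) = k.*2 by rewrite size_cat.
  have : uniq (pre ++ a :: b :: s).
    by apply: subseq_uniq u; rewrite subseq_cat2l /= !eqxx.
  rewrite uniq_mid => /andP[na]; rewrite uniq_mid => /andP[nb _].
  have {}na : a \notin pre ++ s.
    by move: na; rewrite !mem_cat inE !negb_or => /and3P[-> _ ->].
  have E := Pfs_comm0 ss na nb.
  by rewrite mulrA E -mulrA E mulrA.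
have C2 s : subseq s l2 -> (size pre + (size s).+2)%N = k.*2 ->
    X a b * (P k (pre ++ a :: b :: s) * P k (pre ++ a :: b :: s)) =
     (P k (pre ++ a :: b :: s) * P k (pre ++ a :: b :: s)) * X a b.
  move=> sl sk; have ss : size (pre ++ a :: b :: s) = k.*2 by rewrite size_cat.
  have E := Pfs_comm2 ss; rewrite mulrA E ?mem_cat ?inE ?eqxx ?orbT //.
  by rewrite -mulrA E ?mem_cat ?inE ?eqxx ?orbT // mulrA.
(* With x and y the Pfaffians that contain only [a] or only [b], the bracket with [X a b] sends x to
   -y and y to x. The cross terms in the bracket with x^2 + y^2 cancel. *)
have C1 s : subseq s l2 -> (size pre + (size s).+1)%N = k.*2 ->
    X a b * (P k (pre ++ a :: s) * P k (pre ++ a :: s) + P k (pre ++ b :: s) * P k (pre ++ b :: s)) =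
     (P k (pre ++ a :: s) * P k (pre ++ a :: s) + P k (pre ++ b :: s) * P k (pre ++ b :: s)) * X a b.
  move=> sl sk; have sa : size (pre ++ a :: s) = k.*2 by rewrite size_cat.
  have sb : size (pre ++ b :: s) = k.*2 by rewrite size_cat.
  have us : uniq (pre ++ a :: b :: s).
    by apply: subseq_uniq u; rewrite subseq_cat2l /= !eqxx.
  have ua : uniq (pre ++ a :: s).
    by apply: subseq_uniq us; rewrite subseq_cat2l /= eqxx; apply: subseq_cons.
  have ub : uniq (pre ++ b :: s).
    by apply: subseq_uniq us; rewrite subseq_cat2l; apply: subseq_cons.
  have nb : b \notin pre ++ a :: s.
    by move: us; rewrite -cat_rcons uniq_mid cat_rcons => /andP[].
  have na : a \notin pre ++ b :: s.
    by move: us; rewrite uniq_mid => /andP[].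
  have := Pfs_comm1 sb ub na; have := Pfs_comm1 sa ua nb.
  rewrite (XN b a) mulNr mulrN opprK addrC.
  move: (P k _) (P k (pre ++ b :: s)) => x y e1 e2.
  have {}e1 : X a b * x = x * X a b - y by rewrite -e1 opprB addrC addrNK.
  have {}e2 : X a b * y = y * X a b + x by rewrite -e2 addrC addrNK.
  rewrite mulrDr !mulrA e1 e2 mulrBl mulrDl -!mulrA e1 e2 mulrBr !mulrDr.
  have zl (p q r t : A) : p - q - t + (r + t + q) = p + r.
    by rewrite -(addrA p) -opprD -(addrA r) (addrC t) addrACA addNr addr0.
  by rewrite mulrDl !mulrA zl.
have S0 i : (size pre + i)%N = k.*2 ->
    X a b * (\sum_(s <- sublists i l2) P k (pre ++ s) * P k (pre ++ s)) =
    (\sum_(s <- sublists i l2) P k (pre ++ s) * P k (pre ++ s)) * X a b.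
  move=> si; rewrite mulr_sumr mulr_suml !big_seq; apply: eq_bigr => s.
  by rewrite mem_sublists => /andP[sl /eqP ss]; apply: C0; rewrite ?ss.
have S1 i : (size pre + i.+1)%N = k.*2 -> let S :=
     (\sum_(s <- sublists i l2) P k (pre ++ a :: s) * P k (pre ++ a :: s) +
     \sum_(s <- sublists i l2) P k (pre ++ b :: s) * P k (pre ++ b :: s)) in
    X a b * S = S * X a b.
  move=> si /=; rewrite -big_split /= mulr_sumr mulr_suml !big_seq; apply: eq_bigr => s.
  by rewrite mem_sublists => /andP[sl /eqP ss]; apply: C1; rewrite ?ss.
case: j sj => [|[|j]] sj G; rewrite /G.
- by rewrite sublists0 -(sublists0 l2); apply: S0.
- rewrite !sum_sublists_cons [sublists 0 (b :: l2)]sublists0 -(sublists0 l2) addrA.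
  by rewrite mulrDr mulrDl S1 // S0.
rewrite !sum_sublists_cons -!addrA [X in _ + X]addrA mulrDr mulrDl mulrDr mulrDl S1 // S0 //.
congr (_ + _); rewrite mulr_sumr mulr_suml !big_seq; apply: eq_bigr => s.
by rewrite mem_sublists => /andP[sl /eqP ss]; apply: C2; rewrite ?ss.
Qed.

(* [a], [b] span the first coordinate plane, [l] lists the remaining indices, and
   [v] has weight [m] and is killed by the root vectors [X a c - I0 * X b c]. *)
Section HighestWeight.
Variables (I0 : C) (a b : T) (l : seq T) (m : C) (v : A).
Hypothesis I02 : I0 * I0 = -1.
Hypothesis abl : uniq (a :: b :: l).
Hypothesis Hv : X a b * v = (- (I0 * m)) *: v.
Hypothesis Ev : {in l, forall c, X a c * v = I0 *: (X b c * v)}.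

Lemma subseq_abl s : subseq s l -> [/\ a \notin s, b \notin s, a != b & uniq s].
Proof.
move=> sl; have := @subseq_uniq _ (a :: b :: s) _ _ abl.
rewrite /= !eqxx => /(_ sl) /and3P[+ -> ->].
by rewrite inE negb_or => /andP[-> ->].
Qed.

(** In each term of the row expansion the entry of the row shares no index with the smaller
    Pfaffian. It can be moved to the right to act on [v], where [Ev] trades [a] for [b]. *)
Lemma Pfs_row_v k s : size s = k.*2.+1 -> subseq s l ->
  P k.+1 (a :: s) * v = I0 *: (P k.+1 (b :: s) * v).
Proof.
move=> ss sl; have [na nb ab us] := subseq_abl sl.
rewrite !Pfs_row0 ?ss //=; do ?by rewrite ?na ?nb ?us.
rewrite !mulr_suml scaler_sumr; apply: eq_bigr => t _.
have ts : (t < size s)%N by rewrite ss.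
have sr : size (del_nth t s) = k.*2 by rewrite size_del_nth // ss.
have sub : {subset del_nth t s <= s}.
  by apply: mem_subseq; rewrite {2}(del_nthE ts) cat_subseq // subseq_cons.
have nr : nth x0 s t \notin del_nth t s by move: us; rewrite {1}(del_nthE ts) uniq_mid => /andP[].
have E c : c \notin s -> (-1) ^+ t * X c (nth x0 s t) * P k (del_nth t s) * v =
    (-1) ^+ t * (P k (del_nth t s) * (X c (nth x0 s t) * v)).
  by move=> nc; rewrite -(mulrA _ (X _ _)) Pfs_comm0 ?mulrA //; apply: contra nc; apply: sub.
rewrite !E // Ev -?scalerAr //; apply: (mem_subseq sl); exact: mem_nth.
Qed.

(* The average of the expansions of the Pfaffian along [a] and along [b]. *)
Lemma Pfs_ab_v k s : size s = k.*2 -> subseq s l ->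
  P k.+1 (a :: b :: s) * v = (- (I0 * (m + k%:R))) *: (P k s * v).
Proof.
move=> ss sl; have [na nb ab us] := subseq_abl sl.
have usab : uniq (a :: b :: s) by rewrite /= inE negb_or na nb ab us.
pose x t := nth x0 s t; pose w t := P k (b :: del_nth t s).
have xs (t : 'I_k.*2) : x t \in s by rewrite mem_nth ?ss.
have sr (t : 'I_k.*2) : size (del_nth t s) = k.*2.-1 by rewrite size_del_nth ss.
have ltk (t : 'I_k.*2) : (t < size s)%N by rewrite ss.
have xr (t : 'I_k.*2) : x t \notin del_nth t s.
  by have := us; rewrite {1}(del_nthE (ltk t)) uniq_mid => /andP[].
have sub (t : 'I_k.*2) : subseq (del_nth t s) s.
  by rewrite {2}(del_nthE (ltk t)) cat_subseq // subseq_cons.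
have k0 (t : 'I_k.*2) : (0 < k)%N by rewrite -double_gt0; apply: leq_ltn_trans (ltn_ord t).
have swap c (t : 'I_k.*2) : c \notin s -> forall d, d \notin s -> d != c ->
    X c (x t) * P k (d :: del_nth t s) = P k (d :: del_nth t s) * X c (x t).
  move=> nc d nd dc; apply: Pfs_comm0; first by rewrite /= sr; have := k0 t; lia.
    rewrite inE eq_sym (negbTE dc) /=; apply: contra nc; exact: mem_subseq.
  rewrite inE negb_or xr andbT; apply: contraNneq nd => <-; exact: xs.
have E c d : c \notin s -> d \notin s -> c != d -> P k.+1 (c :: d :: s) = X c d * P k s +
    \sum_(t < k.*2) (-1) ^+ t.+1 * X c (x t) * P k (d :: del_nth t s).
  move=> nc nd cd; rewrite Pfs_row0 /= ?ss //; last by rewrite inE negb_or cd nc nd us.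
  by rewrite big_ord_recl mul1r /del_nth /= drop0.
(* Expansion along [a]: the row entry is moved past [w t] and [Ev] replaces its index [a] by [b]. *)
have E1 : P k.+1 (a :: b :: s) * v = X a b * P k s * v +
    I0 *: \sum_(t < k.*2) (-1) ^+ t.+1 * w t * X b (x t) * v.
  rewrite E // mulrDl mulr_suml scaler_sumr; congr (_ + _); apply: eq_bigr => t _.
  rewrite -(mulrA _ (X _ _)) swap // 1?eq_sym // -!mulrA Ev; last exact: mem_subseq sl _ (xs t).
  by rewrite -!scalerAr.
(* Expansion along [b]: here the smaller Pfaffian contains [a], and [Pfs_row_v] turns it into
   [w t]. *)
have E2 : P k.+1 (a :: b :: s) * v = X a b * P k s * v -
    I0 *: \sum_(t < k.*2) (-1) ^+ t.+1 * X b (x t) * w t * v.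
  rewrite (@Pfs_swap k.+1 [::]) /= ?ss // E // 1?eq_sym //.
  rewrite (XN b a) mulNr mulrDl !mulNr opprD opprK.
  congr (_ - _); rewrite mulr_suml scaler_sumr; apply: eq_bigr => t _.
  have k1 := k0 t; have := @Pfs_row_v k.-1 (del_nth t s); rewrite prednK // => ab'.
  rewrite -!mulrA ab' -?scalerAr //; first by rewrite sr; lia.
  exact: subseq_trans (sub t) sl.
(* The two sums differ by brackets of [X b (x t)] with [w t], which put [x t] back in the place of
   [b]. Moving it to its position in [s] absorbs the sign, so each of the 2k terms contributes a
   copy of [P k s]; halving 2k gives the shift by k. *)
have E3 : P k.+1 (a :: b :: s) * v + P k.+1 (a :: b :: s) * v =
   X a b * P k s * v + X a b * P k s * v - (I0 * k.*2%:R) *: (P k s * v).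
  rewrite {1}E1 E2 addrACA; congr (_ + _); rewrite -scalerBr -sumrB.
  rewrite (eq_bigr (fun _ => - (P k s * v))) => [|t _].
    by rewrite sumr_const card_ord -scaler_nat scalerN scalerN scalerA.
  rewrite -mulrBl -!mulrA -mulrBr.
  have := @Pfs_comm1 k [::] (del_nth t s) (x t) b; rewrite /= sr prednK ?double_gt0 ?(k0 t) //.
  move=> /(_ erefl); rewrite (subseq_uniq (sub t)) // andbT => c1.
  have {c1} : X (x t) b * w t - w t * X (x t) b = P k (x t :: del_nth t s).
    apply: c1; first by apply: contra nb; apply: mem_subseq.
    by rewrite inE negb_or xr andbT; apply: contraNneq nb => <-; apply: xs.
  rewrite XN mulNr mulrN opprK addrC => ->.
  have := @Pfs_move k (take t s) (x t) (drop t.+1 s).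
  rewrite -del_nthE ?ss // => /(_ erefl) ->.
  by rewrite size_takel ?ss 1?ltnW // exprS mulN1r !mulNr.
have {}E3 : P k.+1 (a :: b :: s) * v + P k.+1 (a :: b :: s) * v =
  (- (I0 * (m + k%:R))) *: (P k s * v) + (- (I0 * (m + k%:R))) *: (P k s * v).
  rewrite E3 Pfs_comm0 // -mulrA Hv -scalerAr -!scalerDl -scalerBl; congr (_ *: _).
  by rewrite -addnn natrD; ring.
apply/eqP; rewrite -subr_eq0; apply/eqP/alg_2torsion; rewrite opprB.
by apply/eqP; rewrite subr_eq addrAC eq_sym subr_eq E3.
Qed.

(** The Pfaffian of [a :: b :: s] commutes with that of [s], so [Pfs_ab_v] can be applied a second
    time. *)
Lemma Pfs_ab2_v k s : size s = k.*2 -> subseq s l ->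
  P k.+1 (a :: b :: s) * P k.+1 (a :: b :: s) * v =
  - ((m + k%:R) ^+ 2) *: (P k s * P k s * v).
Proof.
move=> ss sl; rewrite -mulrA Pfs_ab_v // -scalerAr mulrA.
rewrite (comm_Pfs ss) => [|c d cs ds]; last first.
  by apply/esym/Pfs_comm2; rewrite /= ?ss // !inE ?cs ?ds !orbT.
rewrite -(mulrA (P k s) (P k.+1 (a :: b :: s)) v) Pfs_ab_v // -scalerAr scalerA mulrA; congr (_ *: _).
by rewrite mulrNN mulrACA I02 mulN1r expr2.
Qed.

(* As [Pf (b s) v = - I0 Pf (a s) v], the sum of squares is [I0] times the
   commutator of [Pf (a s)] and [Pf (b s)]. *)
Lemma Pfs_a2b2_v k s : size s = k.*2.+1 -> subseq s l ->
  P k.+1 (a :: s) * P k.+1 (a :: s) * v + P k.+1 (b :: s) * P k.+1 (b :: s) * v =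
  - (m + k%:R) *: \sum_(t < k.*2.+1) P k (del_nth t s) * P k (del_nth t s) * v.
Proof.
move=> ss sl; have [na nb ab us] := subseq_abl sl.
have ba : P k.+1 (b :: s) * v = - I0 *: (P k.+1 (a :: s) * v).
  by rewrite Pfs_row_v // scalerA mulNr I02 opprK scale1r.
have -> : P k.+1 (a :: s) * P k.+1 (a :: s) * v + P k.+1 (b :: s) * P k.+1 (b :: s) * v =
   I0 *: ((P k.+1 (a :: s) * P k.+1 (b :: s) - P k.+1 (b :: s) * P k.+1 (a :: s)) * v).
  rewrite -2!mulrA Pfs_row_v // {2}ba -(scalerAr I0) -(scalerAr (- I0)) scaleNr -scalerBr.
  by rewrite mulrBl !mulrA.
(* After expansion along [b], the smaller Pfaffians commute with that of [a :: s], and only the row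
   entries contribute. The bracket with [X b (nth x0 s t)] puts [b] in the place of the t-th entry
   of [s]. *)
have -> : P k.+1 (a :: s) * P k.+1 (b :: s) - P k.+1 (b :: s) * P k.+1 (a :: s) =
    - \sum_(t < k.*2.+1) P k (del_nth t s) * P k.+1 (a :: b :: del_nth t s).
  rewrite (@Pfs_row0 k b) //= ?nb // mulr_sumr mulr_suml -sumrB -sumrN.
  apply: eq_bigr => t _; have ts : (t < size s)%N by rewrite ss.
  have sr : size (del_nth t s) = k.*2 by rewrite size_del_nth // ss.
  have sub : {subset del_nth t s <= s}.
    by apply: mem_subseq; rewrite {2}(del_nthE ts) cat_subseq // subseq_cons.
  have c1 : P k.+1 (a :: s) * P k (del_nth t s) = P k (del_nth t s) * P k.+1 (a :: s).
    apply: comm_Pfs => // c d /sub cs /sub ds; apply/esym/Pfs_comm2; rewrite /= ?ss //.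
      by rewrite inE cs orbT.
    by rewrite inE ds orbT.
  have c2 : P k.+1 (a :: b :: del_nth t s) * P k (del_nth t s) = P k (del_nth t s) * P k.+1 (a :: b :: del_nth t s).
    apply: comm_Pfs => // c d cs ds; apply/esym/Pfs_comm2; rewrite /= ?sr //.
      by rewrite !inE cs !orbT.
    by rewrite !inE ds !orbT.
  have sE := del_nthE ts; have := @Pfs_comm1 k.+1 (a :: take t s) (drop t.+1 s) b (nth x0 s t).
  rewrite cat_cons -sE /= ss => /(_ erefl); rewrite na us inE negb_or eq_sym ab nb.
  move=> /(_ isT isT) c3.
  have {c3} : X b (nth x0 s t) * P k.+1 (a :: s) - P k.+1 (a :: s) * X b (nth x0 s t) =
     (-1) ^+ t * P k.+1 (a :: b :: del_nth t s).
    rewrite c3 -cat_cons Pfs_move; last first.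
      by move: (congr1 size sE); rewrite /= !size_cat /= ss; lia.
    rewrite /= size_takel 1?ltnW // -/(del_nth t s) exprS mulN1r mulNr.
    by rewrite (@Pfs_swap k.+1 [::]) ?mulrN ?opprK //= sr.
  move=> c3; rewrite -!mulrA -c1 !mulrA commr_sign -!mulrA -mulrBr !mulrA -mulrBl.
  rewrite -[X in _ * (X * _)]opprK opprB c3 mulNr mulrN -!mulrA c2.
  by rewrite signrMK.
rewrite mulNr mulr_suml scalerN scaleNr; congr (- _).
rewrite !scaler_sumr; apply: eq_bigr => t _; have ts : (t < size s)%N by rewrite ss.
rewrite -(mulrA (P k (del_nth t s)) (P k.+1 (a :: b :: del_nth t s)) v) Pfs_ab_v; first last.
- by apply: subseq_trans sl; rewrite {2}(del_nthE ts) cat_subseq // subseq_cons.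
- by rewrite size_del_nth // ss.
rewrite -(scalerAr (- (I0 * _))) scalerA mulrA; congr (_ *: _).
by rewrite mulrN mulrA I02 mulN1r opprK.
Qed.

(** The sublists are sorted by whether they contain both, one or none of [a] and [b]. Both give -(m
    + k)^2. Exactly one gives -(m + k)(size l - 2k), where the second factor counts deletions. The
    sum of the two is the coefficient. *)
Lemma sum_Pf2_rec k : sum_Pf2 k.+1 (a :: b :: l) * v = sum_Pf2 k.+1 l * v -
  ((m + k%:R) * (m + (size l)%:R - k%:R)) *: (sum_Pf2 k l * v).
Proof.
rewrite /sum_Pf2 doubleS !sum_sublists_cons !mulrDl !mulr_suml.
have -> : \sum_(s <- sublists k.*2 l) P k.+1 (a :: b :: s) * P k.+1 (a :: b :: s) * v =
   - ((m + k%:R) ^+ 2) *: \sum_(s <- sublists k.*2 l) P k s * P k s * v.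
  rewrite scaler_sumr !big_seq; apply: eq_bigr => s; rewrite mem_sublists => /andP[sl /eqP ss].
  exact: Pfs_ab2_v.
set S := \sum_(s <- sublists _ l) P k.+1 s * _ * v.
rewrite -addrA [X in _ + X]addrA -big_split /=.
have -> : \sum_(s <- sublists k.*2.+1 l) (P k.+1 (a :: s) * P k.+1 (a :: s) * v +
    P k.+1 (b :: s) * P k.+1 (b :: s) * v) =
    - (m + k%:R) *: \sum_(s <- sublists k.*2.+1 l) \sum_(t < k.*2.+1) P k (del_nth t s) * P k (del_nth t s) * v.
  rewrite scaler_sumr !big_seq; apply: eq_bigr => s; rewrite mem_sublists => /andP[sl /eqP ss].
  exact: Pfs_a2b2_v.
rewrite (sum_sublists_del _ _ (fun s => P k s * P k s * v)) scalerA addrA -scalerDl addrC.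
by congr (_ + _); rewrite -[RHS]scaleNr; congr (_ *: _); rewrite -addnn natrD; ring.
Qed.

End HighestWeight.

End Pfaffian.

(** * The action of the Pfaffian sums on a highest weight vector *)

Section Eigenvalue.
Variables (C : numFieldType) (A : algType C) (T : eqType) (X : T -> T -> A) (x0 : T).
Hypothesis XX : forall a b c d, X a b * X c d - X c d * X a b =
  (c == b)%:R * X a d - (c == a)%:R * X b d
  + (d == b)%:R * X c a - (d == a)%:R * X c b.
Hypothesis XN : forall a b, X a b = - X b a.
Variables (I0 : C) (l : seq T) (m : nat -> C) (v : A) (r : nat).
Hypothesis I02 : I0 * I0 = -1.
Hypothesis ul : uniq l.
Let n := size l.
Let L p := drop p.*2 l.
Hypothesis m0 : forall p, (r <= p)%N -> m p = 0.
Hypothesis rn : (r.*2 <= n)%N.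
Hypothesis Hv : forall p, (p.*2.+1 < n)%N ->
  X (nth x0 l p.*2) (nth x0 l p.*2.+1) * v = - (I0 * m p) *: v.
Hypothesis Ev : forall p, (p.*2.+1 < n)%N -> {in L p.+1, forall c,
  X (nth x0 l p.*2) c * v = I0 *: (X (nth x0 l p.*2.+1) c * v)}.

Local Notation S2 := (sum_Pf2 X x0).

Lemma sum_Pf2_drop k p : (p.*2.+1 < n)%N -> S2 k.+1 (L p) * v = S2 k.+1 (L p.+1) * v -
  ((m p + k%:R) * (m p + (n - p.+1.*2)%:R - k%:R)) *: (S2 k (L p.+1) * v).
Proof.
move=> pn; have Lp : L p = nth x0 l p.*2 :: nth x0 l p.*2.+1 :: L p.+1.
  by rewrite /L doubleS (drop_nth x0) 1?ltnW // (drop_nth x0 pn).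
rewrite Lp -size_drop; apply: sum_Pf2_rec I02 _ (Hv pn) (Ev pn) _ => //.
by rewrite -Lp drop_uniq.
Qed.

Lemma sum_Pf2_drop_eq0 k p : (r <= p)%N -> S2 k.+1 (L p) * v = 0.
Proof.
move: {2}(n - p)%N (leqnn (n - p)) => N; elim: N p k => [|N IH] p k pN rp; last first.
  case: (ltnP p.*2.+1 n) => pn; last first.
    rewrite /sum_Pf2 big1_seq ?mul0r // => s; rewrite mem_sublists => /= /andP[/size_subseq].
    by rewrite size_drop => le /eqP e; move: le; rewrite e -/n; lia.
  rewrite sum_Pf2_drop // IH //; [|lia..].
  (* With weight 0 the coefficient has the factor [k]: it vanishes for [k = 0], and otherwise the
     lower sum vanishes by induction. *)
  rewrite m0 // !add0r; case: k => [|k]; first by rewrite mul0r scale0r oppr0.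
  by rewrite IH ?scaler0 ?oppr0 //; lia.
rewrite /sum_Pf2 big1_seq ?mul0r // => s; rewrite mem_sublists => /= /andP[/size_subseq].
by rewrite size_drop => le /eqP e; move: le; rewrite e -/n; lia.
Qed.

Lemma sum_Pf2_eigen (z : C) : (\sum_(k < r.+1) (-1) ^+ k *
    (\prod_(k <= j < r) ((j.+1%:R + z) * (j.+1%:R - z - n%:R))) *: S2 k l) * v =
  (\prod_(p < r) ((z + p.+1%:R - m p) * (p.+1%:R - m p - z - n%:R))) *: v.
Proof.
pose h p j : C := ((j + p).+1%:R + z) * ((j + p).+1%:R - z - n%:R).
suff [la [la1 la2 la3 la4]] : exists la : nat -> C, [/\ la 0%N = 1,
    forall k, (-1) ^+ k *: (S2 k (L 0) * v) = la k *: v,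
    forall k, (r < k)%N -> la k = 0 &
    \sum_(k < r.+1) la k * (\prod_(k <= j < r) h 0 j) =
    \prod_(0 <= p < r) ((z + p.+1%:R - m p) * (p.+1%:R - m p - z - n%:R))].
  rewrite mulr_suml -(big_mkord predT (fun p => (z + p.+1%:R - m p) * (p.+1%:R - m p - z - n%:R))).
  rewrite -la4 scaler_suml; apply: eq_bigr => k _.
  rewrite -scalerAl (mulrC ((-1) ^+ k)).
  rewrite -(scalerA _ ((-1) ^+ k)); have := la2 k; rewrite /L drop0 => ->; rewrite scalerA mulrC.
  by congr (_ * _ *: _); apply: eq_bigr => j _; rewrite /h addn0.
(* [N] is the number of planes among the first [r] that have not yet been split off. The eigenvalues
   [la] depend on [p], and the products on both sides are shifted accordingly. *)
suff H N p : (p + N = r)%N -> exists la : nat -> C, [/\ la 0%N = 1,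
    forall k, (-1) ^+ k *: (S2 k (L p) * v) = la k *: v,
    forall k, (N < k)%N -> la k = 0 &
    \sum_(k < N.+1) la k * (\prod_(k <= j < N) h p j) =
    \prod_(p <= q < r) ((z + q.+1%:R - m q) * (q.+1%:R - m q - z - n%:R))].
  exact: H.
elim: N p => [|N IH] p pr.
  exists (fun k => (k == 0%N)%:R); split=> //.
  - case=> [|k]; first by rewrite scale1r sum_Pf2_0 mul1r scale1r.
    by rewrite sum_Pf2_drop_eq0 ?scaler0 ?scale0r //; lia.
  - by case.
  - by rewrite big_ord1 !big_geq ?mulr1 //; lia.
have [la' [la1 la2 la3 la4]] := IH p.+1 (etrans (addSnnS _ _) pr).
have pn : (p.*2.+1 < n)%N by apply: leq_trans rn; lia.
pose g k := (m p + k%:R) * (m p + (n - p.+1.*2)%:R - k%:R).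
(* The sign in [(-1) ^+ k] turns the minus of [sum_Pf2_drop] into a plus. *)
exists (fun k => la' k + (if k is k'.+1 then g k' * la' k' else 0)); split.
- by rewrite addr0.
- case=> [|k]; first by rewrite la1 addr0 scale1r sum_Pf2_0 mul1r scale1r.
  rewrite sum_Pf2_drop // scalerBr la2 scalerDl; congr (_ + _).
  have e (c : C) y : (-1) ^+ k.+1 *: (c *: y) = - (c *: ((-1) ^+ k *: y)) :> A.
    by rewrite !scalerA -scaleNr exprS; congr (_ *: _); ring.
  by rewrite e opprK la2 scalerA.
- by case=> // k kN; rewrite !la3 ?mulr0 ?addr0 //; lia.
rewrite [RHS]big_ltn; last by lia.
rewrite -la4 mulr_sumr.
transitivity (\sum_(k < N.+2) la' k * \prod_(k <= j < N.+1) h p j +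
   \sum_(k < N.+2) (if (k : nat) is k'.+1 then g k' * la' k' else 0) *
     \prod_(k <= j < N.+1) h p j).
  by rewrite -big_split; apply: eq_bigr => k _; rewrite mulrDl.
rewrite big_ord_recr /= la3 // mul0r addr0 [X in _ + X]big_ord_recl mul0r add0r.
rewrite -big_split; apply: eq_bigr => k _ /=.
rewrite /bump /= add1n big_ltn; last by have := ltn_ord k; lia.
have -> : \prod_(k.+1 <= i < N.+1) h p i = \prod_(k <= j < N) h p.+1 j.
  by rewrite big_add1 /=; apply: eq_bigr => j _; rewrite /h addSnnS.
move: (\prod_(_ <= j < N) _) => w.
(* With F(x) = (x + z)(x - z - n) and q = p + 1 this is F(q + k) = F(q - m p) - g k. Thus
   [h p k + g k] does not depend on [k], and the factor of the plane [p] comes out of the sum. *)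
have -> : h p k = (z + p.+1%:R - m p) * (p.+1%:R - m p - z - n%:R) - g k.
  rewrite /h /g natrB; last by apply: leq_trans pn; lia.
  rewrite -addnn !natrD; ring.
ring.
Qed.

End Eigenvalue.

(** * Derivatives of complex and matrix valued functions *)

Section ComplexDerivative.
Variable R : realType.
Local Notation C := R[i].
Local Notation Re := complex.Re.
Local Notation Im := complex.Im.

(** Real and imaginary parts are kept apart as in [Xop] and [smooth], so that real one-variable
    calculus applies to each. *)
Definition is_cderive (f : R -> C) (t : R) (d : C) :=
  is_derive t (1 : R) (fun x => Re (f x) : R) (Re d) /\
  is_derive t (1 : R) (fun x => Im (f x) : R) (Im d).

Lemma ReD (x y : C) : Re (x + y) = Re x + Re y. Proof. by case: x; case: y. Qed.
Lemma ImD (x y : C) : Im (x + y) = Im x + Im y. Proof. by case: x; case: y. Qed.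
Lemma ReM (x y : C) : Re (x * y) = Re x * Re y - Im x * Im y.
Proof. by case: x; case: y. Qed.
Lemma ImM (x y : C) : Im (x * y) = Re x * Im y + Im x * Re y.
Proof. by case: x => a b; case: y => c d /=; ring. Qed.

Lemma is_cderive_ext (f g : R -> C) t d :
  (\near t, f t = g t) -> is_cderive f t d -> is_cderive g t d.
Proof.
move=> fg [d1 d2]; split; [move: d1|move: d2]; apply: near_eq_is_derive.
  by near=> x; rewrite (near fg x).
by near=> x; rewrite (near fg x).
Unshelve. all: by end_near. Qed.

Lemma is_cderive_cst (c : C) t : is_cderive (fun=> c) t 0.
Proof. by split; apply: is_derive_cst. Qed.

Lemma is_cderiveD f g t a b : is_cderive f t a -> is_cderive g t b ->
  is_cderive (fun x => f x + g x) t (a + b).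
Proof.
move=> [f1 f2] [g1 g2]; split.
  by rewrite ReD; under eq_fun do rewrite ReD; apply: is_deriveD.
by rewrite ImD; under eq_fun do rewrite ImD; apply: is_deriveD.
Qed.

Lemma is_derive_mul (f g : R -> R) t a b : is_derive t (1 : R) f a ->
  is_derive t (1 : R) g b -> is_derive t (1 : R) (fun x => f x * g x) (a * g t + f t * b).
Proof.
move=> df dg; apply: (is_derive_eq (is_deriveM df dg)).
by rewrite /GRing.scale /=; ring.
Qed.

Lemma is_cderiveM f g t a b : is_cderive f t a -> is_cderive g t b ->
  is_cderive (fun x => f x * g x) t (a * g t + f t * b).
Proof.
move=> [f1 f2] [g1 g2]; split.
  under eq_fun do rewrite ReM.
  apply: (is_derive_eq (is_deriveB (is_derive_mul f1 g1) (is_derive_mul f2 g2))).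
  by rewrite !(ReD, ReM); ring.
under eq_fun do rewrite ImM.
apply: (is_derive_eq (is_deriveD (is_derive_mul f1 g2) (is_derive_mul f2 g1))).
by rewrite !(ImD, ImM); ring.
Qed.

Lemma is_cderive_sum (I : Type) (r : seq I) (P : pred I) (f : I -> R -> C) t (d : I -> C) :
  (forall i, P i -> is_cderive (f i) t (d i)) ->
  is_cderive (fun x => \sum_(i <- r | P i) f i x) t (\sum_(i <- r | P i) d i).
Proof.
move=> fd; elim: r => [|i r IH].
  by rewrite big_nil; under eq_fun do rewrite big_nil; apply: is_cderive_cst.
rewrite big_cons; under eq_fun do rewrite big_cons.
by case: ifP => // Pi; apply: is_cderiveD => //; apply: fd.
Qed.

Lemma is_cderive_comp (f : R -> C) (phi : R -> R) t (e : R) d :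
  is_derive t (1 : R) phi e -> is_cderive f (phi t) d ->
  is_cderive (fun x => f (phi x)) t (d * e%:C).
Proof.
move=> dp [f1 f2]; split.
  apply: (is_derive_eq (is_derive1_comp f1 dp)).
  by rewrite ReM /=; ring.
apply: (is_derive_eq (is_derive1_comp f2 dp)).
by rewrite ImM /=; ring.
Qed.

Lemma is_cderive_real (phi : R -> R) t (e : R) :
  is_derive t (1 : R) phi e -> is_cderive (fun x => (phi x)%:C) t e%:C.
Proof. by move=> dp; split => //=; apply: is_derive_cst. Qed.

Lemma is_cderive_unique f t a b : is_cderive f t a -> is_cderive f t b -> a = b.
Proof.
move=> [a1 a2] [b1 b2]; case: a a1 a2 => x y /= a1 a2; case: b b1 b2 => z w /= b1 b2.
by congr (_ +i* _); rewrite -[LHS]derive_val -[RHS]derive_val.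
Qed.

Lemma is_cderive_0_cst f (x y : R) : (forall t, is_cderive f t 0) -> f x = f y.
Proof.
move=> f0; apply/eqP; rewrite eq_complex; apply/andP; split; apply/eqP.
  by apply: (@is_derive_0_is_cst _ (fun t => Re (f t))) => t; case: (f0 t).
by apply: (@is_derive_0_is_cst _ (fun t => Im (f t))) => t; case: (f0 t).
Qed.

Definition is_mxderive p q (F : R -> 'M[C]_(p, q)) t (D : 'M[C]_(p, q)) :=
  forall i j, is_cderive (fun x => F x i j) t (D i j).

Lemma is_mxderive_cst p q (M : 'M[C]_(p, q)) t : is_mxderive (fun=> M) t 0.
Proof. by move=> i j; rewrite mxE; apply: is_cderive_cst. Qed.

Lemma is_mxderive_mul p q u (F : R -> 'M[C]_(p, q)) (G : R -> 'M[C]_(q, u)) t A B :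
  is_mxderive F t A -> is_mxderive G t B ->
  is_mxderive (fun x => F x *m G x) t (A *m G t + F t *m B).
Proof.
move=> dF dG i j; rewrite !mxE -big_split /=; under eq_fun do rewrite mxE.
by apply: is_cderive_sum => k _; apply: is_cderiveM.
Qed.

Lemma is_mxderive_add p q (F G : R -> 'M[C]_(p, q)) t A B :
  is_mxderive F t A -> is_mxderive G t B -> is_mxderive (fun x => F x + G x) t (A + B).
Proof.
move=> dF dG i j; rewrite mxE; under eq_fun do rewrite mxE; exact: is_cderiveD.
Qed.

Lemma is_mxderive_scale p q (f : R -> C) (M : 'M[C]_(p, q)) t d :
  is_cderive f t d -> is_mxderive (fun x => f x *: M) t (d *: M).
Proof.
move=> df i j; rewrite mxE; under eq_fun do rewrite mxE.
rewrite -[d * _]addr0 -[X in _ + X](mulr0 (f t)).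
exact: is_cderiveM df (is_cderive_cst _ _).
Qed.

Lemma is_mxderive_comp p q (F : R -> 'M[C]_(p, q)) (phi : R -> R) t (e : R) D :
  is_derive t (1 : R) phi e -> is_mxderive F (phi t) D ->
  is_mxderive (fun x => F (phi x)) t (e%:C *: D).
Proof.
by move=> dp dF i j; rewrite mxE mulrC; apply: (is_cderive_comp (f := fun x => F x i j)) dp (dF i j).
Qed.

Lemma is_mxderive_ext p q (F G : R -> 'M[C]_(p, q)) t D :
  (\near t, F t = G t) -> is_mxderive F t D -> is_mxderive G t D.
Proof.
move=> FG dF i j; apply: is_cderive_ext (dF i j).
by near=> x; rewrite (near FG x).
Unshelve. all: by end_near. Qed.

Lemma is_mxderive_unique p q (F : R -> 'M[C]_(p, q)) t A B :
  is_mxderive F t A -> is_mxderive F t B -> A = B.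
Proof. by move=> a b; apply/matrixP => i j; apply: is_cderive_unique (a i j) (b i j). Qed.

Lemma is_mxderive_0_cst p q (F : R -> 'M[C]_(p, q)) x y :
  (forall t, is_mxderive F t 0) -> F x = F y.
Proof.
move=> F0; apply/matrixP => i j; apply: (is_cderive_0_cst (f := fun t => F t i j)) => t.
by have := F0 t i j; rewrite mxE.
Qed.

End ComplexDerivative.

(** * Rotations *)

Section Rotations.
Variables (R : realType) (n : nat).
Implicit Types (g : 'M[R]_n) (a b c : 'I_n) (s t : R).

Lemma mul_delta_mxE a b g i j : (delta_mx a b *m g) i j = (i == a)%:R * g b j.
Proof.
rewrite mxE (bigD1 b) //= big1 => [|k kb]; first by rewrite mxE eqxx andbT addr0.
by rewrite mxE (negbTE kb) andbF mul0r.
Qed.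

Lemma mxD_E p q (A B : 'M[R]_(p, q)) i j : (A + B) i j = A i j + B i j.
Proof. by rewrite mxE. Qed.
Lemma mxB_E p q (A B : 'M[R]_(p, q)) i j : (A - B) i j = A i j - B i j.
Proof. by rewrite !mxE. Qed.
Lemma mxZ_E p q (k : R) (A : 'M[R]_(p, q)) i j : (k *: A) i j = k * A i j.
Proof. by rewrite mxE. Qed.

Lemma expX_mulE a b t g i j : a != b -> (expX_mx a b t *m g) i j =
  if i == a then cos t * g a j + sin t * g b j
  else if i == b then cos t * g b j - sin t * g a j else g i j.
Proof.
move=> ab; have ba : b != a by rewrite eq_sym.
have XE (h : 'M[R]_n) k l : (Xmx R a b *m h) k l = (k == a)%:R * h b l - (k == b)%:R * h a l.
  by rewrite /Xmx mulmxBl mxB_E !mul_delta_mxE.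
rewrite /expX_mx; move: (Xmx R a b) XE => X XE.
rewrite !mulmxDl mul1mx -!scalemxAl -mulmxA !mxD_E !mxZ_E !XE.
rewrite !eqxx (negbTE ab) (negbTE ba) !(mul0r, mul1r, subr0, sub0r).
have [->|ia] := eqVneq i a; first by rewrite (negbTE ab) /= !(mul0r, mul1r); ring.
by have [->|ib] := eqVneq i b; rewrite /= ?(mul0r, mul1r); ring.
Qed.

Lemma expX_diag a t : expX_mx a a t = 1%:M.
Proof. by rewrite /expX_mx /Xmx subrr mulmx0 !scaler0 !addr0. Qed.

Lemma expX_opp a b t : expX_mx b a t = expX_mx a b (- t).
Proof.
rewrite /expX_mx sinN cosN; have -> : Xmx R b a = - Xmx R a b by rewrite /Xmx opprB.
by rewrite mulNmx mulmxN opprK scalerN scaleNr.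
Qed.

Lemma expX0 a b : expX_mx a b 0 = 1%:M :> 'M[R]_n.
Proof. by rewrite /expX_mx sin0 cos0 subrr !scale0r !addr0. Qed.

(** With an arbitrary matrix on the right, products of rotations are evaluated from the left as
    successive row operations by [expX_mulE]. *)
Lemma mulmx_ext (A B : 'M[R]_n) : (forall g : 'M[R]_n, A *m g = B *m g) -> A = B.
Proof. by move/(_ 1%:M); rewrite !mulmx1. Qed.

Lemma expXD a b s t : expX_mx a b (s + t) = expX_mx a b s *m expX_mx a b t.
Proof.
have [->|ab] := eqVneq a b; first by rewrite !expX_diag mulmx1.
apply: mulmx_ext => g; apply/matrixP => i j.
rewrite -mulmxA !expX_mulE // !eqxx cosD sinD [b == a]eq_sym ?(negbTE ab).
have [_|ia] := eqVneq i a; first by ring.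
by have [_|ib] := eqVneq i b => //; ring.
Qed.

Lemma expX_comm a b c d s t : uniq [:: a; b; c; d] ->
  expX_mx a b s *m expX_mx c d t = expX_mx c d t *m expX_mx a b s.
Proof.
rewrite /= !inE !negb_or => /and4P[/and3P[ab ac ad] /andP[bc bd] cd _].
apply: mulmx_ext => g; apply/matrixP => i j.
rewrite -!mulmxA !expX_mulE // ?eqxx ![c == _]eq_sym ![d == _]eq_sym.
rewrite (negbTE ac) (negbTE ad) (negbTE bc) (negbTE bd).
have [ia|ia] := eqVneq i a; first by rewrite ia (negbTE ac) (negbTE ad).
by have [ib|ib] := eqVneq i b; first by rewrite ib (negbTE bc) (negbTE bd).
Qed.

(* Tait-Bryan angles of a product of two coordinate rotations; [w = 1 / cos be]. *)
Lemma expX_euler a b c (w : R) s t al be ga : uniq [:: a; b; c] ->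
  cos s != 0 ->
  w ^+ 2 * (1 - (sin t * cos s) ^+ 2) = 1 ->
  cos al = cos t * w -> sin al = sin s * sin t * w ->
  cos be * w = 1 -> sin be = sin t * cos s ->
  cos ga = cos s * cos t * w -> sin ga = sin s * w ->
  expX_mx a b s *m expX_mx b c t =
  expX_mx a c al *m expX_mx b c be *m expX_mx a b ga.
Proof.
rewrite /= !inE !negb_or => /and3P[/andP[ab ac] bc _] cs0 w2 ca sa cb sb cg sg.
have hs := cos2Dsin2 s; have ht := cos2Dsin2 t.
apply: mulmx_ext => g; apply/matrixP => i j.
rewrite -!mulmxA !expX_mulE // ?eqxx ![c == _]eq_sym ?[b == a]eq_sym.
rewrite ?(negbTE ab) ?(negbTE ac) ?(negbTE bc).
rewrite ca sa sb cg sg.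
set x := cos s in hs w2 *; set y := sin s in hs *; set z := cos t in ht *.
set u := sin t in ht w2 *; set p := cos be in cb *.
have e1 : w ^+ 2 * (z ^+ 2 + y ^+ 2 * u ^+ 2) = 1.
  rewrite -w2; have -> : y ^+ 2 = 1 - x ^+ 2 by rewrite -hs; ring.
  have -> : z ^+ 2 = 1 - u ^+ 2 by rewrite -ht; ring.
  by ring.
have e3 : w ^+ 2 * (x ^+ 2 * z ^+ 2 + y ^+ 2) = 1.
  rewrite -w2; have -> : y ^+ 2 = 1 - x ^+ 2 by rewrite -hs; ring.
  have -> : z ^+ 2 = 1 - u ^+ 2 by rewrite -ht; ring.
  by ring.
have [_|_] := eqVneq i a.
  transitivity (x * (w ^+ 2 * (z ^+ 2 + y ^+ 2 * u ^+ 2)) * g a j +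
     y * z * (w ^+ 2 * (1 - (u * x) ^+ 2)) * g b j + y * u * (p * w) * g c j).
    by rewrite e1 w2 cb; ring.
  by ring.
have [ib|_] := eqVneq i b.
  rewrite ib (negbTE bc).
  transitivity (x * z * (p * w) * g b j + x * u * g c j - y * (p * w) * g a j).
    by rewrite cb; ring.
  by ring.
have [_|//] := eqVneq i c.
transitivity (z * (p * w) * g c j - u * (w ^+ 2 * (x ^+ 2 * z ^+ 2 + y ^+ 2)) * g b j).
  by rewrite e3 cb; ring.
by ring.
Qed.

Lemma sum_sqr_gt0 (x y : R) : x ^+ 2 + y ^+ 2 = 1 -> 0 < x -> `|y| < 1.
Proof.
move=> e x0; rewrite -(ltr_pXn2r (_ : 0 < 2)%N) ?nnegrE //.
by rewrite expr1n real_normK ?num_real // -e ltrDr exprn_gt0.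
Qed.

Lemma sqr_inj_gt0 (x y : R) : 0 < x -> 0 < y -> x ^+ 2 = y ^+ 2 -> x = y.
Proof. by move=> x0 y0 /eqP; rewrite eqrXn2 ?ltW // => /eqP. Qed.

(** Positivity of both cosines keeps sin t cos s inside (-1, 1), so the square root in [w] is
    positive. The cosines of [al] and [ga] are positive as cosines of arctangents, hence determined
    by their squares. The explicit angles are what is differentiated at [t = 0] later. *)
Lemma euler_angles s t : 0 < cos s -> 0 < cos t ->
  let al := atan (sin s * tan t) in
  let be := asin (sin t * cos s) in
  let ga := atan (tan s * (cos t)^-1) in
  forall a b c, uniq [:: a; b; c] ->
  expX_mx a b s *m expX_mx b c t =
  expX_mx a c al *m expX_mx b c be *m expX_mx a b ga.
Proof.
move=> cs ct al be ga a b c u3.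
have hs := cos2Dsin2 s; have ht := cos2Dsin2 t.
have sb1 : `|sin t * cos s| < 1.
  rewrite normrM; have := sum_sqr_gt0 ht ct => st1.
  have cs1 : `|cos s| <= 1 by rewrite ler_norml cos_geN1 cos_le1.
  by apply: le_lt_trans st1; rewrite ler_piMr.
have sb : -1 <= sin t * cos s <= 1 by rewrite -ler_norml ltW.
set D := 1 - (sin t * cos s) ^+ 2.
have D0 : 0 < D.
  by rewrite subr_gt0 -real_normK ?num_real // exprn_ilt1.
pose w := (Num.sqrt D)^-1.
have w0 : 0 < w by rewrite invr_gt0 sqrtr_gt0.
have w2 : w ^+ 2 * D = 1 by rewrite exprVn sqr_sqrtr ?ltW // mulVf ?gt_eqF.
have pos1 (x : R) : 0 < 1 + x ^+ 2 by rewrite ltr_pwDl ?sqr_ge0.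
have catan (x : R) : 0 < cos (atan x).
  rewrite cos_atan invr_gt0 sqrtr_gt0. exact: pos1.
have satan (x : R) : sin (atan x) = x * cos (atan x).
  rewrite -{2}[x]atanK /tan mulfVK //; exact: lt0r_neq0 (catan _).
have catan2 (x : R) : cos (atan x) ^+ 2 * (1 + x ^+ 2) = 1.
  rewrite cos_atan exprVn sqr_sqrtr; last exact: ltW (pos1 _).
  by rewrite mulVf //; exact: lt0r_neq0 (pos1 _).
have cal : cos al = cos t * w.
  apply: sqr_inj_gt0 (catan _) (mulr_gt0 ct w0) _; rewrite exprMn.
  apply: (mulIf (_ : 1 + (sin s * tan t) ^+ 2 != 0)); first exact: lt0r_neq0 (pos1 _).
  rewrite catan2 -[LHS]w2 [RHS]mulrAC [RHS]mulrC; congr (_ * _).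
  rewrite /D /tan; have -> : (sin t * cos s) ^+ 2 = sin t ^+ 2 - sin t ^+ 2 * sin s ^+ 2.
    rewrite exprMn; have -> : cos s ^+ 2 = 1 - sin s ^+ 2 by rewrite -hs; ring.
    by ring.
  transitivity (cos t ^+ 2 + sin t ^+ 2 * sin s ^+ 2); first by rewrite -ht; ring.
  field; exact: lt0r_neq0.
have cga : cos ga = cos s * cos t * w.
  apply: sqr_inj_gt0 (catan _) _ _; first by rewrite !mulr_gt0.
  rewrite exprMn.
  apply: (mulIf (_ : 1 + (tan s * (cos t)^-1) ^+ 2 != 0)); first exact: lt0r_neq0 (pos1 _).
  rewrite catan2 -[LHS]w2 [RHS]mulrAC [RHS]mulrC; congr (_ * _).
  rewrite /D /tan; have -> : (sin t * cos s) ^+ 2 = cos s ^+ 2 - (cos t * cos s) ^+ 2.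
    rewrite exprMn; have -> : sin t ^+ 2 = 1 - cos t ^+ 2 by rewrite -ht; ring.
    by ring.
  transitivity (sin s ^+ 2 + (cos t * cos s) ^+ 2); first by rewrite -hs; ring.
  by field; rewrite !lt0r_neq0.
apply: (@expX_euler _ _ _ w) => //.
- by rewrite gt_eqF.
- by rewrite satan cal /tan; field; rewrite lt0r_neq0.
- by rewrite cos_asin // mulfV // gt_eqF // sqrtr_gt0.
- by rewrite asinK // in_itv.
- by rewrite satan cga /tan; field; rewrite !lt0r_neq0.
Qed.

Definition refl_mx c : 'M[R]_n := diag_mx (\row_i (-1) ^+ (i == c)).

Lemma refl_mulE c g i j : (refl_mx c *m g) i j = (-1) ^+ (i == c) * g i j.
Proof. by rewrite mul_diag_mx !mxE. Qed.

Lemma refl_mx_orth c : refl_mx c *m (refl_mx c)^T = 1%:M.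
Proof.
apply/matrixP => i j; rewrite refl_mulE tr_diag_mx !mxE.
by have [->|_] := eqVneq i j; rewrite ?mulr0n ?mulr0 // mulr1n -signr_addb addbb.
Qed.

Lemma refl_expX a b c t : a != b -> refl_mx c *m expX_mx a b t =
  expX_mx a b ((-1) ^+ ((a == c) (+) (b == c)) * t) *m refl_mx c.
Proof.
move=> ab; apply: mulmx_ext => g; apply/matrixP => i j.
rewrite -!mulmxA refl_mulE !expX_mulE // !refl_mulE.
have -> : sin ((-1) ^+ ((a == c) (+) (b == c)) * t) =
     (-1) ^+ (a == c) * (-1) ^+ (b == c) * sin t.
  by rewrite -signr_addb !mulr_sign; case: ifP; rewrite ?sinN.
have -> : cos ((-1) ^+ ((a == c) (+) (b == c)) * t) = cos t.
  by rewrite !mulr_sign; case: ifP; rewrite ?cosN.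
have [ia|ia] := eqVneq i a.
  by rewrite ia; case: (a == c); case: (b == c); rewrite /= ?(expr0, expr1); ring.
have [ib|ib] := eqVneq i b => //.
by rewrite ib; case: (a == c); case: (b == c); rewrite /= ?(expr0, expr1); ring.
Qed.

Lemma rotation_angle (x y : R) : exists t, cos t * y - sin t * x = 0.
Proof.
have [->|x0] := eqVneq x 0.
  by exists (pi / 2); rewrite cos_pihalf mul0r mulr0 subrr.
exists (atan (y / x)).
have c0 : cos (atan (y / x)) != 0.
  by rewrite cos_atan invr_eq0 gt_eqF // sqrtr_gt0 ltr_pwDl ?sqr_ge0.
have -> : sin (atan (y / x)) = y / x * cos (atan (y / x)).
  by rewrite -{2}[y / x]atanK /tan mulfVK.
by rewrite mulrAC mulfVK // mulrC subrr.
Qed.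

(* Givens elimination with rotations in adjacent coordinate planes *)
Lemma orthogonal_ind (Pr : 'M[R]_n -> Prop) :
  Pr 1%:M ->
  (forall a b t g, b = a.+1 :> nat -> Pr g -> Pr (expX_mx a b t *m g)) ->
  (forall c g, Pr g -> Pr (refl_mx c *m g)) ->
  forall g, g *m g^T = 1%:M -> Pr g.
Proof.
move=> P1 PX Pr_refl.
pose std k (g : 'M[R]_n) := forall i j : 'I_n, (j < k)%N -> g i j = (i == j)%:R.
suff H k g : (k <= n)%N -> std k g -> g *m g^T = 1%:M -> Pr g by move=> g; exact: (H 0%N).
move: {2}(n - k)%N (erefl (n - k)%N) => N; elim: N k g => [|N IHN] k g Nk kn sg og.
  suff -> : g = 1%:M by [].
  by apply/matrixP => i j; rewrite !mxE sg //; apply: leq_trans (ltn_ord j) _; lia.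
have kn' : (k < n)%N by lia.
pose c := Ordinal kn'.
have og' := mulmx1C og.
(* The columns are orthonormal and the first [k] are standard basis vectors, so the entries of
   column [c] in the first [k] rows vanish. *)
have gz (i : 'I_n) : (i < k)%N -> g i c = 0.
  move=> ik; have := congr1 (fun M : 'M[R]_n => M i c) og'.
  rewrite !mxE (bigD1 i) //= !mxE sg // eqxx mul1r big1 => [|l li].
    by rewrite addr0 -val_eqE /= ltn_eqF.
  by rewrite !mxE sg // (negbTE li) mul0r.
have orth_mul (h : 'M[R]_n) : h *m h^T = 1%:M -> (h *m g) *m (h *m g)^T = 1%:M.
  by move=> oh; rewrite trmx_mul mulmxA -(mulmxA h) og mulmx1.
(* [l] bounds the rows in which column [c] may be nonzero. Rotations in the planes of the rows
   [l.-1] and [l] lower it to [k]; the first [k] columns have zeros in these rows and are not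
   disturbed. *)
suff T l g' : (l < n)%N -> (k <= l)%N -> std k g' -> g' *m g'^T = 1%:M ->
    (forall i : 'I_n, (l < i)%N || (i < k)%N -> g' i c = 0) -> Pr g'.
  apply: (T n.-1) => //; [lia|lia|move=> i /orP[|/gz //]; have := ltn_ord i; lia].
move: {2}(l - k)%N (erefl (l - k)%N) => D.
elim: D l g' => [|D IHD] l g' Dl ln kl sg' og2 gz'.
  have kE : l = k by lia.
  have gc : g' c c ^+ 2 = 1.
    have := congr1 (fun M : 'M[R]_n => M c c) (mulmx1C og2).
    rewrite !mxE (bigD1 c) //= !mxE eqxx big1 ?addr0 // => i ic.
    rewrite !mxE gz' ?mul0r // kE; move: ic; rewrite -val_eqE /=; lia.
  have sk (h : 'M[R]_n) : std k h -> (forall i, h i c = (i == c)%:R) -> std k.+1 h.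
    move=> sh hc i j; rewrite ltnS leq_eqVlt => /orP[/eqP jk|]; last exact: sh.
    by rewrite (_ : j = c) //; apply: val_inj.
  have gic i : i != c -> g' i c = 0.
    by move=> ic; apply: gz'; rewrite kE; move: ic; rewrite -val_eqE /=; lia.
  (* Column [c] is now plus or minus a basis vector, and a reflection corrects the sign. *)
  move/eqP: gc; rewrite sqrf_eq1 => /orP[/eqP g1|/eqP gN1].
    apply: (IHN k.+1) => //; first lia.
    by apply: sk => // i; have [->|ic] := eqVneq i c; [rewrite g1|rewrite gic].
  suff : Pr (refl_mx c *m g').
    move=> /(Pr_refl c); rewrite mulmxA.
    have {2}-> : refl_mx c = (refl_mx c)^T by rewrite tr_diag_mx.
    by rewrite refl_mx_orth mul1mx.
  apply: (IHN k.+1) => //; first lia.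
    apply: sk => [i j jk|i].
      rewrite refl_mulE sg' //; have [ic|] := eqVneq i c; last by rewrite mul1r.
      by rewrite ic -val_eqE /= gtn_eqF ?mulr0.
    by rewrite refl_mulE; have [->|ic] := eqVneq i c; rewrite ?gN1 ?gic ?mulr0 // expr1 mulrNN mulr1.
  by rewrite trmx_mul mulmxA -(mulmxA (refl_mx c)) og2 mulmx1 refl_mx_orth.
case: l Dl ln kl gz' => [|l]; first by lia.
move=> Dl ln kl gz'; pose b := Ordinal ln; pose a := Ordinal (ltnW ln).
have ab : a != b by rewrite -val_eqE /=; lia.
have [t tE] := rotation_angle (g' a c) (g' b c).
suff : Pr (expX_mx a b t *m g').
  move=> /(PX a b (- t) _ erefl); rewrite mulmxA -expXD addNr expX0 mul1mx.
  by [].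
apply: (IHD l) => //; [lia|lia|lia|..].
- move=> i j jk; rewrite expX_mulE // !sg' //.
  have aj : (a == j) = false by rewrite -val_eqE /=; lia.
  have bj : (b == j) = false by rewrite -val_eqE /=; lia.
  rewrite aj bj; have [->|_] := eqVneq i a; first by rewrite aj !mulr0 addr0.
  by have [->|_] := eqVneq i b; rewrite // bj !mulr0 subr0.
- rewrite trmx_mul mulmxA -(mulmxA (expX_mx a b t)) og2 mulmx1.
  exact/eqP/expX_subproof.
move=> i il; rewrite expX_mulE //; case: eqVneq => [ia|ia].
  by move: il; rewrite ia /=; lia.
have [ib|ib] := eqVneq i b; first by [].
by apply: gz'; move: il ia ib; rewrite -!val_eqE /=; lia.
Qed.

End Rotations.

(** * Smooth functions *)

Section Functions.
Variables (R : realType) (n r : nat).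
Local Notation C := R[i].
Local Notation G := (O_ R n).
Local Notation Gr := (Gr R n r).
Local Notation fn := (fn R n r).
Local Notation expX := (@expX R n).

Lemma O_act_mul (g h k : G) (f : fn) :
  val k = val g *m val h -> O_act k f = O_act g (O_act h f).
Proof.
move=> e; apply/funext => P; rewrite /O_act; congr f; apply: val_inj => /=.
by rewrite e trmx_mul !trmx_mul !trmxK !mulmxA.
Qed.

Lemma O_act1 (g : G) (f : fn) : val g = 1%:M -> O_act g f = f.
Proof.
move=> e; apply/funext => P; rewrite /O_act; congr f; apply: val_inj => /=.
by rewrite e !trmx1 mul1mx mulmx1.
Qed.

Lemma O_act_linear (g : G) (c : C) (u v : fn) :
  O_act g (c *: u + v) = c *: O_act g u + O_act g v.
Proof. by []. Qed.

Lemma O_act_sum (g : G) (I : Type) (s : seq I) (c : I -> C) (u : I -> fn) :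
  O_act g (\sum_(i <- s) c i *: u i) = \sum_(i <- s) c i *: O_act g (u i).
Proof.
elim: s => [|i s IH]; first by rewrite !big_nil.
by rewrite !big_cons O_act_linear IH.
Qed.

Lemma Xop_unique a b (f : fn) P d :
  is_cderive (fun t => O_act (expX a b t) f P) 0 d -> Xop a b f P = d.
Proof.
case: d => x y [/= d1 d2]; rewrite /Xop !derive1E.
by congr (_ +i* _); apply: derive_val.
Qed.

Lemma derivable_cderive a b (f : fn) P :
  derivable (fun t : R => complex.Re (O_act (expX a b t) f P) : R) 0 1 /\
  derivable (fun t : R => complex.Im (O_act (expX a b t) f P) : R) 0 1 ->
  is_cderive (fun t => O_act (expX a b t) f P) 0 (Xop a b f P).
Proof.
by move=> [d1 d2]; split; [move/derivableP: d1|move/derivableP: d2]; rewrite -derive1E.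
Qed.

Lemma smooth_cderive a b (f : fn) P : smooth f ->
  is_cderive (fun t => O_act (expX a b t) f P) 0 (Xop a b f P).
Proof. by move=> /(_ [::])[_ _ /(_ a b P)]; exact: derivable_cderive. Qed.

Lemma is_cderiveZ (c : C) (f : R -> C) t d :
  is_cderive f t d -> is_cderive (fun x => c * f x) t (c * d).
Proof.
move=> df; rewrite -[c * d]add0r -(mul0r (f t)).
exact: is_cderiveM (is_cderive_cst c t) df.
Qed.

Lemma Xop_linear a b (c : C) (u v : fn) : smooth u -> smooth v ->
  Xop a b (c *: u + v) = c *: Xop a b u + Xop a b v.
Proof.
move=> su sv; apply/funext => P; apply: Xop_unique.
apply: is_cderiveD; last exact: smooth_cderive.
by apply: is_cderiveZ; apply: smooth_cderive.
Qed.

Lemma smooth_Xword w (f : fn) : smooth f -> smooth (Xword w f).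
Proof. by move=> sf w'; have := sf (w' ++ w); rewrite /Xword foldr_cat. Qed.

Lemma Xword_cons a b w (f : fn) : Xword ((a, b) :: w) f = Xop a b (Xword w f).
Proof. by []. Qed.

Lemma Xword_linear w (c : C) (u v : fn) : smooth u -> smooth v ->
  Xword w (c *: u + v) = c *: Xword w u + Xword w v.
Proof.
move=> su sv; elim: w => [//|[a b] w IH].
rewrite !Xword_cons IH; exact: Xop_linear (smooth_Xword w su) (smooth_Xword w sv).
Qed.

Lemma smooth_linear (c : C) (u v : fn) : smooth u -> smooth v -> smooth (c *: u + v).
Proof.
move=> su sv w /=; rewrite Xword_linear //.
have [cu1 cu2 du] := su w; have [cv1 cv2 dv] := sv w.
set U := Xword w u in cu1 cu2 du *; set V := Xword w v in cv1 cv2 dv *.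
have E P : (c *: U + V) P = c * U P + V P by [].
have ReE P : complex.Re ((c *: U + V) P) = complex.Re c * complex.Re (U P)
   - complex.Im c * complex.Im (U P) + complex.Re (V P) by rewrite E; move: (U P) (V P) => [x y] [z t]; case: (c).
have ImE P : complex.Im ((c *: U + V) P) = complex.Re c * complex.Im (U P)
   + complex.Im c * complex.Re (U P) + complex.Im (V P) by rewrite E; move: (U P) (V P) => [x y] [z t]; case: (c).
split.
- under eq_fun do rewrite ReE; move=> P.
  exact: (cvgD (cvgB (cvgM (cvg_cst _) (cu1 P)) (cvgM (cvg_cst _) (cu2 P))) (cv1 P)).
- under eq_fun do rewrite ImE; move=> P.
  exact: (cvgD (cvgD (cvgM (cvg_cst _) (cu2 P)) (cvgM (cvg_cst _) (cu1 P))) (cv2 P)).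
move=> a b P; have HU := derivable_cderive (du a b P).
have HV := derivable_cderive (dv a b P).
have [e1 e2] := is_cderiveD (is_cderiveZ c HU) HV.
by split; [exact: (@ex_derive _ _ _ _ _ _ _ e1)|exact: (@ex_derive _ _ _ _ _ _ _ e2)].
Qed.

Lemma smooth0 : smooth (0 : fn).
Proof.
have X_diag a b : Xop a b (0 : fn) = 0.
  apply/funext => P; apply: Xop_unique; exact: is_cderive_cst.
have W0 w : Xword w (0 : fn) = 0 by elim: w => //= ab w ->.
move=> w /=; rewrite W0; split; do ?exact: cst_continuous.
by move=> a b P; split; apply: derivable_cst.
Qed.

Lemma smooth_sum (I : Type) (s : seq I) (Q : pred I) (u : I -> fn) :
  (forall i, Q i -> smooth (u i)) -> smooth (\sum_(i <- s | Q i) u i).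
Proof.
move=> su; elim: s => [|i s IH]; first by rewrite big_nil; apply: smooth0.
rewrite big_cons; case: ifP => Qi; last exact: IH.
rewrite -[u i]scale1r; exact: smooth_linear (su i Qi) IH.
Qed.

Lemma smoothZ (c : C) (u : fn) : smooth u -> smooth (c *: u).
Proof. move=> su; rewrite -[_ *: _]addr0; exact: smooth_linear su smooth0. Qed.

Lemma Xop0 a b : Xop a b (0 : fn) = 0.
Proof. apply/funext => P; apply: Xop_unique; exact: is_cderive_cst. Qed.

Lemma Xop_sum a b (I : Type) (s : seq I) (Q : pred I) (c : I -> C) (u : I -> fn) :
  (forall i, Q i -> smooth (u i)) ->
  Xop a b (\sum_(i <- s | Q i) c i *: u i) = \sum_(i <- s | Q i) c i *: Xop a b (u i).
Proof.
move=> su; elim: s => [|i s IH]; first by rewrite !big_nil Xop0.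
rewrite !big_cons; case: ifP => Qi; last exact: IH.
rewrite -IH; apply: Xop_linear; first exact: su.
by apply: smooth_sum => j Qj; apply/smoothZ/su.
Qed.

Section FiniteDimensional.
Variable W : set fn.
Hypothesis subW : Defs.subspace W.
Hypothesis fdW : findim W.

Lemma subspace_sum (I : Type) (s : seq I) (c : I -> C) (u : I -> fn) :
  (forall i, W (u i)) -> W (\sum_(i <- s) c i *: u i).
Proof.
move=> Wu; elim: s => [|i s IH]; last first.
  by rewrite big_cons; have [_ Wl] := subW; exact: Wl (Wu i) IH.
by rewrite big_nil; have [W0 _] := subW; exact: W0.
Qed.

Lemma sum_fnE (I : Type) (s : seq I) (u : I -> fn) P :
  (\sum_(i <- s) u i) P = \sum_(i <- s) u i P.
Proof. by elim: s => [|i s IH]; rewrite ?big_nil // !big_cons -IH. Qed.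

Let dual d (p : 'I_d -> Gr) (w : 'I_d -> fn) :=
  (forall j, W (w j)) /\ forall i j, w j (p i) = (i == j)%:R.

(* A dual system of points and functions has at most as many members as a
   spanning family of [W], and one which does not span [W] can be enlarged. *)
Lemma findim_dual_basis : exists d (p : 'I_d -> Gr) (w : 'I_d -> fn),
  [/\ forall j, W (w j), forall i j, w j (p i) = (i == j)%:R &
      forall u, W u -> u = \sum_j u (p j) *: w j].
Proof.
have [N [b Nb]] := fdW.
apply: contrapT => nex.
suff /(_ N.+1)[p [w [Ww wp]]] : forall d, exists (p : 'I_d -> Gr) (w : 'I_d -> fn), dual p w.
  have /choice[c wc] : forall j, exists c : 'I_N -> C, w j = \sum_i c i *: b i.
    by move=> j; apply: Nb.
  pose B := \matrix_(i < N.+1, k < N) b k (p i).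
  pose D := \matrix_(k < N, j < N.+1) c j k.
  (* A dual system of size [N.+1] would factor the identity matrix through dimension [N]. *)
  have e : B *m D = 1%:M.
    apply/matrixP => i j; rewrite !mxE -wp wc sum_fnE; apply: eq_bigr => k _.
    by rewrite !mxE mulrC.
  have := mulmx_max_rank B D; rewrite e mxrank1; lia.
elim=> [|d [p [w [Ww wp]]]].
  by exists (fun i : 'I_0 => False_rect Gr (notF (ltn_ord i))), (fun=> 0); split => -[].
have [u Wu [q uq]] : exists2 u, W u & exists q, u q - \sum_j u (p j) * w j q != 0.
  apply: contrapT => nu; apply: nex; exists d, p, w; split=> // u Wu.
  apply/funext => q; apply/eqP; rewrite -subr_eq0; apply/negPn/negP => uq.
  by apply: nu; exists u => //; exists q; move: uq; rewrite sum_fnE.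
set k : C := u q - _ in uq.
(* [v] is the error of the interpolation of [u] at the points [p j], scaled to have value 1 at [q].
   It vanishes at the old points. *)
pose v : fn := (k^-1 : C) *: (u - \sum_j (u (p j) : C) *: w j).
have Wv : W v.
  have [W0 Wl] := subW; rewrite /v -[_ *: _]addr0; apply: (Wl) W0.
  by rewrite addrC -scaleN1r; apply: (Wl) Wu; apply: subspace_sum.
have vE x : v x = k^-1 * (u x - \sum_j u (p j) * w j x).
  rewrite /v -[LHS]/(k^-1 * (u x - (\sum_j (u (p j) : C) *: w j) x)).
  by rewrite sum_fnE.
have vq : v q = 1 by rewrite vE mulVf.
have vp i : v (p i) = 0.
  rewrite vE (bigD1 i) //= wp eqxx mulr1 big1 => [|j ji]; first by rewrite addr0 subrr mulr0.
  by rewrite wp eq_sym (negbTE ji) mulr0.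
exists (fun i => if unlift ord_max i is Some j then p j else q).
(* The multiple of [v] makes the old functions vanish at [q] without changing their values at the
   old points. *)
exists (fun i => if unlift ord_max i is Some j then (- (w j q : C)) *: v + w j else v).
split=> [j|i j].
  case: unliftP => [j' _|_]; last exact: Wv.
  by have [_ Wl] := subW; exact: Wl Wv (Ww j').
case: (unliftP ord_max i) => [i' ->|->]; case: (unliftP ord_max j) => [j' ->|->].
- rewrite (inj_eq lift_inj) -wp -[LHS]/(- w j' q * v (p i') + w j' (p i')).
  by rewrite vp mulr0 add0r.
- by rewrite vp eq_sym (negbTE (neq_lift _ _)).
- rewrite (negbTE (neq_lift _ _)) -[LHS]/(- w j' q * v q + w j' q).
  by rewrite vq mulr1 addNr.
by rewrite eqxx vq.
Qed.

End FiniteDimensional.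
End Functions.

(** * Finite-dimensional invariant spaces *)

(** Antisymmetry, commutation of disjoint pairs and the case of one shared index determine the
    bracket for every coincidence of indices. *)
Lemma so_bracket (C : numFieldType) (A : algType C) (T : eqType) (X : T -> T -> A) :
  (forall a b, X b a = - X a b) ->
  (forall a b c d, uniq [:: a; b; c; d] -> X a b * X c d = X c d * X a b) ->
  (forall a b c, uniq [:: a; b; c] -> X a b * X b c - X b c * X a b = X a c) ->
  forall a b c d, X a b * X c d - X c d * X a b =
  (c == b)%:R * X a d - (c == a)%:R * X b d
  + (d == b)%:R * X c a - (d == a)%:R * X c b.
Proof.
move=> XN Xc Xb a b c d.
have X_diag x : X x x = 0 by apply: (@alg_2torsion C A); rewrite -XN.
have [->|ab] := eqVneq a b.
  by rewrite X_diag mul0r mulr0 !subrr add0r subrr.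
have [->|cd] := eqVneq c d.
  rewrite X_diag mul0r mulr0 subrr [X d a]XN [X d b]XN !mulrN opprK.
  by rewrite [X in X + _]addrAC subrr add0r addNr.
have ba : b != a by rewrite eq_sym. have dc : d != c by rewrite eq_sym.
have [ca|ca] := eqVneq c a; have [db|db] := eqVneq d b; rewrite ?ca ?db.
- by rewrite (negbTE ab) (negbTE ba) !X_diag !mulr0 !mul0r !subrr !subr0 !addr0.
- rewrite (negbTE ab) ca in cd dc *; rewrite (negbTE dc).
  rewrite [X a b]XN mulNr mulrN opprK addrC -[X in X = _]opprK opprB Xb.
    by rewrite !mul0r mul1r !subr0 addr0 sub0r.
  by rewrite /= !inE negb_or ba eq_sym db cd.
- rewrite db in cd dc *; rewrite (negbTE cd) (negbTE ba).
  rewrite [X c b]XN mulrN mulNr opprK addrC -[X in X = _]opprK opprB Xb.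
    by rewrite !mul0r mul1r !subr0 add0r XN opprK.
  by rewrite /= !inE negb_or ab eq_sym ca dc.
have [cb|cb] := eqVneq c b; have [da|da] := eqVneq d a; rewrite ?cb ?da.
- by rewrite [X a b]XN mulNr mulrN !(subrr, X_diag, mulr0, mul0r, subr0, addr0).
- rewrite Xb; first by rewrite !(mul0r, mul1r, subr0, addr0).
  by rewrite /= !inE negb_or ab -cb cd eq_sym da.
- rewrite [X a b]XN [X c a]XN mulrNN mulrNN Xb.
    by rewrite !mul0r mul1r subr0 addr0 sub0r XN.
  by rewrite /= !inE negb_or ba eq_sym cb eq_sym ca.
rewrite Xc ?subrr ?mul0r ?subr0 ?addr0 //.
by rewrite /= !inE !negb_or ab ![a == _]eq_sym ca da ![b == _]eq_sym cb db cd.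
Qed.

Lemma uniq_sublists (T : eqType) k (l : seq T) : uniq l -> uniq (sublists k l).
Proof.
elim: l k => [|a l IH] [|k] //= /andP[al ul]; first exact: IH.
rewrite cat_uniq map_inj_uniq ?IH //=; last by move=> s1 s2 [].
rewrite andbT; apply/hasPn => s; rewrite mem_sublists => /andP[sl _].
apply: contra al => /mapP[s' _ e]; move: sl; rewrite e => /mem_subseq; apply.
by rewrite inE eqxx.
Qed.

Lemma ltn_ord_trans n : transitive (fun i j : 'I_n => (i < j)%N).
Proof. by move=> j i k; apply: ltn_trans. Qed.

Lemma sorted_enum_ord n : sorted (fun i j : 'I_n => (i < j)%N) (enum 'I_n).
Proof. by have := iota_ltn_sorted 0 n; rewrite -val_enum_ord sorted_map. Qed.

Lemma codom_ordE k n (I : {ffun 'I_k -> 'I_n}) : codom I = [seq I i | i <- enum 'I_k].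
Proof. by []. Qed.

Lemma nth_codom_ord k n x0 (I : {ffun 'I_k -> 'I_n}) (i : 'I_k) : nth x0 (codom I) i = I i.
Proof.
by rewrite codom_ordE (@nth_map _ i _ x0 _ _ (enum 'I_k)) ?size_enum_ord // nth_ord_enum.
Qed.

Lemma sum_increasing (V : nmodType) k n (F : seq 'I_n -> V) :
  \sum_(I : {ffun 'I_k -> 'I_n} | increasing I) F (codom I) =
  \sum_(s <- sublists k (enum 'I_n)) F s.
Proof.
rewrite -big_filter -(big_map (fun I : {ffun 'I_k -> 'I_n} => codom I) predT F).
apply: perm_big; apply: uniq_perm.
- rewrite map_inj_uniq ?filter_uniq ?index_enum_uniq // => I J e.
  apply/ffunP => i; have := congr1 (fun s => nth (I i) s i) e.
  by rewrite !nth_codom_ord.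
- exact/uniq_sublists/enum_uniq.
move=> s; rewrite mem_sublists; apply/mapP/andP => [[I]|[sl /eqP ss]].
  rewrite mem_filter => /andP[/forallP incI _] ->.
  rewrite size_codom card_ord eqxx; split=> //.
  have sI : sorted (fun i j : 'I_n => (i < j)%N) (codom I).
    rewrite codom_ordE sorted_map; apply: sub_sorted (sorted_enum_ord k) => i j ij.
    by have /forallP/(_ j)/implyP/(_ ij) := incI i.
  suff -> : codom I = [seq i <- enum 'I_n | i \in codom I] by apply: filter_subseq.
  apply: (irr_sorted_eq (@ltn_ord_trans n)) sI _ _ => [i||i]; first by rewrite /= ltnn.
    by apply: sorted_filter (sorted_enum_ord n); apply: ltn_ord_trans.
  by rewrite mem_filter mem_enum andbT.
(* [nth] takes a default index, which exists only for positive [n]. *)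
case: n F s sl ss => [|n] F s sl ss.
  have s0 : s = [::] by move: sl; rewrite enum_ord0 subseq0 => /eqP.
  have k0 : k = 0%N by rewrite -ss s0.
  exists [ffun i : 'I_k => cast_ord k0 i].
    rewrite mem_filter mem_index_enum andbT; apply/forallP => i.
    by have := ltn_ord i; rewrite {2}k0.
  by rewrite s0; case: (codom _) (size_codom [ffun i : 'I_k => cast_ord k0 i]) => //; rewrite card_ord k0.
exists [ffun i : 'I_k => nth ord0 s i].
  rewrite mem_filter mem_index_enum andbT; apply/forallP => i; apply/forallP => j.
  apply/implyP => ij; rewrite !ffunE.
  have sS := subseq_sorted (@ltn_ord_trans n.+1) sl (sorted_enum_ord n.+1).
  by apply: (sorted_ltn_nth (@ltn_ord_trans n.+1) ord0 sS); rewrite ?inE ?ss.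
apply: (@eq_from_nth _ ord0); first by rewrite size_codom card_ord.
move=> i; rewrite ss => ik; by rewrite (nth_codom_ord _ _ (Ordinal ik)) ffunE.
Qed.

Lemma delta_bracket (K : comPzRingType) n (a b c d : 'I_n) :
  let X (a b : 'I_n) : 'M[K]_n := delta_mx a b - delta_mx b a in
  X a b *m X c d - X c d *m X a b =
  (c == b)%:R *: X a d - (c == a)%:R *: X b d
  + (d == b)%:R *: X c a - (d == a)%:R *: X c b.
Proof.
move=> X; rewrite /X !(mulmxBl, mulmxBr) !mul_delta_mx_cond.
rewrite ![a == _]eq_sym ![b == _]eq_sym !mulrb.
move: (delta_mx a d) (delta_mx d a) (delta_mx b d) (delta_mx d b) (delta_mx a c)
  (delta_mx c a) (delta_mx b c) (delta_mx c b) => D1 D2 D3 D4 D5 D6 D7 D8.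
by case: (c == a); case: (c == b); case: (d == a); case: (d == b);
  apply/matrixP => i j; rewrite !mxE; ring.
Qed.

Lemma Xmx_bracket (R : realType) n (a b c d : 'I_n) :
  Xmx R[i] a b *m Xmx R[i] c d - Xmx R[i] c d *m Xmx R[i] a b =
  (c == b)%:R *: Xmx R[i] a d - (c == a)%:R *: Xmx R[i] b d
  + (d == b)%:R *: Xmx R[i] c a - (d == a)%:R *: Xmx R[i] c b.
Proof. exact: (@delta_bracket R[i] n a b c d). Qed.

Lemma commutator_subZ (K : comPzRingType) n (c : K) (H U V : 'M[K]_n) :
  H *m (U - c *: V) - (U - c *: V) *m H =
  (H *m U - U *m H) - c *: (H *m V - V *m H).
Proof. by rewrite mulmxBr mulmxBl -scalemxAr -scalemxAl scalerBr !opprD addrACA. Qed.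

Lemma skew_subZ (K : comPzRingType) n (c : K) (U V : 'M[K]_n) :
  U^T = - U -> V^T = - V -> (U - c *: V)^T = - (U - c *: V).
Proof. by move=> eU eV; rewrite linearB linearZ /= eU eV scalerN [RHS]opprD. Qed.

Lemma scale_i_identity (K : numClosedFieldType) p q (x y z : K) (U1 U2 V1 V2 V3 V4 : 'M[K]_(p, q)) :
  'i *: (- (x *: U1) + y *: V1 - z *: V2 - 'i *: (x *: U2 + y *: V3 - z *: V4)) =
  x *: (U2 - 'i *: U1) + ('i * y) *: (V1 - 'i *: V3) - ('i * z) *: (V2 - 'i *: V4).
Proof.
apply/matrixP => i j; rewrite !mxE; apply/eqP; rewrite -subr_eq0; apply/eqP.
transitivity (- ('i * 'i + 1) * (x * U2 i j)); first by ring.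
by rewrite -expr2 sqrCi addNr oppr0 mul0r.
Qed.

Lemma weight_identity (K : numClosedFieldType) p q (x y : K) (b : bool) (U V : 'M[K]_(p, q)) :
  (x *: U + ('i * 0) *: V - ('i * y) *: V) -
    ('i * (-1) ^+ b) *: (x *: V + ('i * y) *: U - ('i * 0) *: U) =
  (x + (-1) ^+ b * y) *: (U - ('i * (-1) ^+ b) *: V).
Proof.
apply/matrixP => i j; rewrite !mxE; apply/eqP; rewrite -subr_eq0; apply/eqP.
set e := (-1) ^+ b.
transitivity (- ('i * 'i + 1) * (e * y * U i j) + (e * e - 1) * ('i * y * V i j)); first by ring.
by rewrite -expr2 sqrCi addNr oppr0 mul0r -signr_addb addbb subrr mul0r addr0.
Qed.

Section RootVectors.
Variables (R : realType) (n : nat).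
Local Notation C := R[i].
Local Notation f := (fst_pos (half_double_leq n)).
Local Notation s := (snd_pos (half_double_leq n)).
Variable p : 'I_n./2.

(* [root_mx c] has weight 1 under [H_p]; the rotations in the plane of [c] mix it
   with its neighbour, see [root_vector_pair]. *)
Definition root_mx (c : 'I_n) : 'M[C]_n := Xmx C (f p) c - 'i *: Xmx C (s p) c.

Lemma fst_pos_eq i j : (f i == f j) = (i == j).
Proof. by rewrite -!val_eqE /=; lia. Qed.
Lemma snd_pos_eq i j : (s i == s j) = (i == j).
Proof. by rewrite -!val_eqE /=; lia. Qed.
Lemma fst_snd_pos_eq i j : (f i == s j) = false.
Proof. by rewrite -!val_eqE /=; lia. Qed.
Lemma snd_fst_pos_eq i j : (s i == f j) = false.
Proof. by rewrite -!val_eqE /=; lia. Qed.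

Lemma Hmx_root_mx j c : Hmx R j *m root_mx c - root_mx c *m Hmx R j =
  (p == j)%:R *: root_mx c + ('i * (c == s j)%:R) *: root_mx (f j)
  - ('i * (c == f j)%:R) *: root_mx (s j).
Proof.
have -> : Hmx R j *m root_mx c - root_mx c *m Hmx R j =
   'i *: ((Xmx C (f j) (s j) *m Xmx C (f p) c - Xmx C (f p) c *m Xmx C (f j) (s j)) -
     'i *: (Xmx C (f j) (s j) *m Xmx C (s p) c - Xmx C (s p) c *m Xmx C (f j) (s j))).
  rewrite /Hmx /root_mx; move: (Xmx _ _ _) (Xmx _ _ _) (Xmx _ _ _) => U H V.
  rewrite -scalemxAl -scalemxAr -scalerBr; congr (_ *: _).
  exact: commutator_subZ.
rewrite !Xmx_bracket fst_pos_eq snd_pos_eq fst_snd_pos_eq snd_fst_pos_eq /root_mx.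
rewrite !scale0r !(sub0r, subr0).
have e (U : 'I_n./2 -> 'M[C]_n) : (p == j)%:R *: U j = (p == j)%:R *: U p.
  by case: eqVneq => [->|_] //; rewrite !scale0r.
rewrite (e (fun j => Xmx C (s j) c)) (e (fun j => Xmx C (f j) c)).
exact: scale_i_identity.
Qed.

Lemma root_mx_skew c : (root_mx c)^T = - root_mx c.
Proof. by apply: skew_subZ; rewrite /Xmx linearB /= !trmx_delta opprB. Qed.

(** [Hmx q] mixes [root_mx (f q)] and [root_mx (s q)]; the combination is its eigenvector for the
    eigenvalue [(-1) ^+ b]. Thus [b = false] gives the root e_p + e_q and [b = true] gives e_p -
    e_q. *)
Lemma root_vector_pair (b : bool) (q : 'I_n./2) (al : 'I_n./2 -> int) :
  (p < q)%N -> (forall k, al k = (k == p)%:Z + (-1) ^+ b * (k == q)%:Z) ->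
  root_vector al (root_mx (f q) - ('i * (-1) ^+ b) *: root_mx (s q)).
Proof.
move=> pq alE; split=> [|j].
  by apply: skew_subZ; apply: root_mx_skew.
have E1 : Hmx R j *m root_mx (f q) - root_mx (f q) *m Hmx R j =
    (p == j)%:R *: root_mx (f q) + ('i * 0) *: root_mx (s q) - ('i * (q == j)%:R) *: root_mx (s q).
  apply: etrans (Hmx_root_mx j (f q)) _; rewrite fst_pos_eq fst_snd_pos_eq.
  have [->|_] := eqVneq q j; move: (root_mx (f _)) (root_mx (s _)) => U V.
    by rewrite !mulr0 !scale0r.
  by move: (root_mx (f j)) (root_mx (s j)) => U' V'; rewrite !mulr0 !scale0r.
have E2 : Hmx R j *m root_mx (s q) - root_mx (s q) *m Hmx R j =
    (p == j)%:R *: root_mx (s q) + ('i * (q == j)%:R) *: root_mx (f q) - ('i * 0) *: root_mx (f q).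
  apply: etrans (Hmx_root_mx j (s q)) _; rewrite snd_pos_eq snd_fst_pos_eq.
  have [->|_] := eqVneq q j; move: (root_mx (f _)) (root_mx (s _)) => U V.
    by rewrite !mulr0 !scale0r.
  by move: (root_mx (f j)) (root_mx (s j)) => U' V'; rewrite !mulr0 !scale0r.
apply: etrans (commutator_subZ _ _ _ _) _.
apply: etrans (congr2 (fun U V => U - _ *: V) E1 E2) _.
apply: etrans (weight_identity _ _ _ _ _) _; congr (_ *: _).
by rewrite alE rmorphD rmorphM rmorphXn rmorphN1 /= -!pmulrn ![_ == j]eq_sym.
Qed.

(** The index [c] lies in no coordinate plane, so it is the last one and [n] is odd; this is the
    short root e_p. *)
Lemma root_vector_single (c : 'I_n) (al : 'I_n./2 -> int) :
  (n./2.*2 <= c)%N -> (forall k, al k = (k == p)%:Z) -> root_vector al (root_mx c).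
Proof.
move=> nc alE; split=> [|j].
  exact: root_mx_skew.
have jn := ltn_ord j.
have cs : (c == s j) = false by rewrite -val_eqE /=; lia.
have cf : (c == f j) = false by rewrite -val_eqE /=; lia.
apply: etrans (Hmx_root_mx j c) _.
by rewrite cs cf mulr0 !scale0r subr0 addr0 alE eq_sym -pmulrn.
Qed.

End RootVectors.

(** Recovers the two separate vanishing statements from the pair of roots e_p + e_q and e_p -
    e_q. *)
Lemma scale_pm_i_eq0 (K : numClosedFieldType) (V : lmodType K) (x y : V) :
  x - ('i * (-1) ^+ false) *: y = 0 -> x - ('i * (-1) ^+ true) *: y = 0 -> x = 0 /\ y = 0.
Proof.
rewrite expr0 expr1 mulr1 mulrN1 scaleNr opprK => e1 e2.
have x0 : x = 0.
  have /eqP : x *+ 2 = 0.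
    by rewrite mulr2n -[RHS]addr0 -{1}e1 -e2 addrACA addNr addr0.
  by rewrite -scaler_nat scaler_eq0 pnatr_eq0 => /eqP.
split=> //; apply/eqP; move/eqP: e2; rewrite x0 add0r scaler_eq0.
by rewrite (negbTE (neq0Ci _)).
Qed.

(** This and [Dhat_factor] are the substitution z = 2 nu + 1, which brings both sides to the form of
    [sum_Pf2_eigen]. *)
Lemma ck_factor (K : comPzRingType) (nu j N : K) :
  (j + 2 * nu + 1) * (j - (2 * nu + N + 1)) =
  (j + (2 * nu + 1)) * (j - (2 * nu + 1) - N).
Proof. ring. Qed.

Lemma Dhat_factor (K : numFieldType) (nu j m N : K) :
  (nu + (j + 1) / 2 - m / 2) * (nu + N / 2 - (j - 1) / 2 + m / 2) =
  - (1 / 4) * ((2 * nu + 1 + j - m) * (j - m - (2 * nu + 1) - N)).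
Proof. by field. Qed.

(** * Matrices of the group and of its Lie algebra on an invariant space *)

Section Representation.
Variables (R : realType) (n r : nat).
Local Notation C := R[i].
Local Notation G := (O_ R n).
Local Notation Gr := (Gr R n r).
Local Notation fn := (fn R n r).
Local Notation expX := (@expX R n).
Variable W : set fn.
Hypothesis subW : Defs.subspace W.
Hypothesis invW : forall g u, W u -> W (O_act g u).
Hypothesis smW : forall u, W u -> smooth u.
Variables (d : nat) (p : 'I_d.+1 -> Gr) (w : 'I_d.+1 -> fn).
Hypothesis Ww : forall j, W (w j).
Hypothesis wp : forall i j, w j (p i) = (i == j)%:R.
Hypothesis Wspan : forall u, W u -> u = \sum_j u (p j) *: w j.

(** In the dual basis the coordinates of a function of [W] are its values at the points [p i], so
    the entries of [rho] along a rotation are functions that [smooth] makes differentiable. *)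
Definition ev (u : fn) : 'cV[C]_d.+1 := \col_i u (p i).
Definition opmx (T : fn -> fn) : 'M[C]_d.+1 := \matrix_(i, j) T (w j) (p i).
Definition rho (g : G) := opmx (O_act g).
Definition Mx a b := opmx (Xop a b).

Lemma ev_linear (c : C) (u v : fn) : ev (c *: u + v) = c *: ev u + ev v.
Proof. by apply/colP => i; rewrite !mxE. Qed.

Lemma evZ (c : C) (u : fn) : ev (c *: u) = c *: ev u.
Proof. by apply/colP => i; rewrite !mxE. Qed.

Lemma ev_sum (I : Type) (s : seq I) (Q : pred I) (u : I -> fn) :
  ev (\sum_(i <- s | Q i) u i) = \sum_(i <- s | Q i) ev (u i).
Proof.
elim: s => [|i s IH]; first by rewrite !big_nil; apply/colP => i; rewrite !mxE.
rewrite !big_cons; case: ifP => // _; rewrite -IH.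
by apply/colP => j; rewrite !mxE.
Qed.

Lemma ev_inj (u v : fn) : W u -> W v -> ev u = ev v -> u = v.
Proof.
move=> Wu Wv e; rewrite (Wspan Wu) (Wspan Wv); apply: eq_bigr => j _.
by have := congr1 (fun c : 'cV[C]_d.+1 => c j 0) e; rewrite !mxE => ->.
Qed.

Lemma ev_op (T : fn -> fn) u : W u ->
  T u = \sum_j u (p j) *: T (w j) -> ev (T u) = opmx T *m ev u.
Proof.
move=> Wu ->; rewrite ev_sum; apply/colP => i; rewrite summxE !mxE.
by apply: eq_bigr => j _; rewrite !mxE mulrC.
Qed.

Lemma ev_O g u : W u -> ev (O_act g u) = rho g *m ev u.
Proof. by move=> Wu; apply: ev_op => //; rewrite {1}(Wspan Wu) O_act_sum. Qed.

Lemma rhoM (g h k : G) : val k = val g *m val h -> rho k = rho g *m rho h.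
Proof.
move=> e; apply/matrixP => i j.
have -> : rho k i j = ev (O_act k (w j)) i 0 by rewrite !mxE.
rewrite (O_act_mul _ e) ev_O; last exact: invW (Ww j).
by rewrite !mxE; apply: eq_bigr => l _; rewrite !mxE.
Qed.

Lemma rho1 (g : G) : val g = 1%:M -> rho g = 1%:M.
Proof. by move=> e; apply/matrixP => i j; rewrite !mxE O_act1 // wp. Qed.

(** The translates of [u] by rotations stay in [W], so they have an expansion in the [w j] for every
    angle, and its coefficients can be differentiated. *)
Lemma Xop_W a b u : W u -> Xop a b u = \sum_j Xop a b u (p j) *: w j.
Proof.
move=> Wu; apply/funext => P; rewrite sum_fnE; apply: Xop_unique.
under eq_fun => t do rewrite (Wspan (invW (expX a b t) Wu)) sum_fnE.
apply: is_cderive_sum => j _.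
have -> : (fun x => (O_act (expX a b x) u (p j) *: w j) P) =
   (fun x => w j P * O_act (expX a b x) u (p j)) by apply/funext => x; rewrite mulrC.
have -> : (Xop a b u (p j) *: w j) P = w j P * Xop a b u (p j) by rewrite mulrC.
by apply/is_cderiveZ/smooth_cderive/smW.
Qed.

Lemma W_Xop a b u : W u -> W (Xop a b u).
Proof. by move=> Wu; rewrite Xop_W //; apply: subspace_sum. Qed.

Lemma ev_Xop a b u : W u -> ev (Xop a b u) = Mx a b *m ev u.
Proof.
move=> Wu; apply: ev_op => //; rewrite {1}(Wspan Wu) Xop_sum // => j _.
exact: smW (Ww j).
Qed.

Lemma rho_der0 a b : is_mxderive (fun t => rho (expX a b t)) 0 (Mx a b).
Proof.
move=> i j; rewrite mxE; under eq_fun do rewrite mxE.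
exact: smooth_cderive (smW (Ww j)).
Qed.

Lemma rho_expXD a b s t : rho (expX a b (s + t)) = rho (expX a b s) *m rho (expX a b t).
Proof. by apply: rhoM; rewrite /= expXD. Qed.

Lemma rho_expX0 a b : rho (expX a b 0) = 1%:M.
Proof. by apply: rho1; rewrite /= expX0. Qed.

Lemma rho_der a b t :
  is_mxderive (fun x => rho (expX a b x)) t (rho (expX a b t) *m Mx a b).
Proof.
have -> : (fun x => rho (expX a b x)) =
    (fun x => rho (expX a b t) *m rho (expX a b (x - t))).
  by apply/funext => x; rewrite -rho_expXD addrC subrK.
have ds : is_derive t (1 : R) (fun x : R => x - t) 1.
  by apply: (is_derive_eq (is_deriveB (is_derive_id t 1) (is_derive_cst t t 1))); rewrite subr0.
have := @is_mxderive_comp R _ _ (fun x => rho (expX a b x)) _ t 1 (Mx a b) ds.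
rewrite /= subrr => /(_ (rho_der0 a b)) dF.
have := is_mxderive_mul (is_mxderive_cst (rho (expX a b t)) t) dF.
by rewrite /= mul0mx add0r scale1r.
Qed.

Lemma MxN a b : Mx b a = - Mx a b.
Proof.
have D1 := rho_der0 b a; apply: is_mxderive_unique D1 _.
have -> : (fun t => rho (expX b a t)) = (fun t => rho (expX a b (- t))).
  by apply/funext => t; congr rho; apply: val_inj; rewrite /= expX_opp.
have ds : is_derive (0 : R) (1 : R) (fun x : R => - x) (- 1).
  exact: (is_deriveN (is_derive_id (0 : R) (1 : R))).
have := @is_mxderive_comp R _ _ (fun x => rho (expX a b x)) _ 0 _ (Mx a b) ds.
rewrite /= oppr0 => /(_ (rho_der0 a b)).
by rewrite rmorphN scaleN1r.
Qed.

(** Both sides of the conjugation identity are differentiated at angle 0; [eps] is the inner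
    derivative. *)
Lemma rho_Mx_comm (g : G) a b c e (eps : R) :
  (forall t, val g *m expX_mx a b t = expX_mx c e (eps * t) *m val g) ->
  rho g *m Mx a b = eps%:C *: Mx c e *m rho g.
Proof.
move=> ge.
have [D1 D2] : is_mxderive (fun t => rho g *m rho (expX a b t)) 0 (rho g *m Mx a b) /\
  is_mxderive (fun t => rho (expX c e (eps * t)) *m rho g) 0 (eps%:C *: Mx c e *m rho g).
  split.
    have := is_mxderive_mul (is_mxderive_cst (rho g) 0) (rho_der0 a b).
    by rewrite mul0mx add0r.
  have di : is_derive (0 : R) (1 : R) (fun t : R => eps * t) eps.
    apply: (is_derive_eq (is_derive_mul (is_derive_cst eps (0 : R) (1 : R)) (is_derive_id (0 : R) (1 : R)))).
    by rewrite mul0r add0r mulr1.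
  have := is_mxderive_comp (F := fun t => rho (expX c e t)) di.
  move=> /(_ (Mx c e)); rewrite mulr0 => /(_ (rho_der0 c e)) dF.
  by have := is_mxderive_mul dF (is_mxderive_cst (rho g) 0); rewrite mulmx0 addr0.
apply: is_mxderive_unique D1 _; move: D2; congr is_mxderive.
apply/funext => t.
have oX : (val g *m expX_mx a b t) *m (val g *m expX_mx a b t)^T == 1%:M.
  rewrite trmx_mul mulmxA -(mulmxA (val g)) (eqP (expX_subproof a b t)) mulmx1.
  exact: valP g.
pose k : G := exist _ (val g *m expX_mx a b t) oX.
by rewrite -(@rhoM _ _ k) ?(@rhoM g (expX a b t) k) //= ge.
Qed.

Lemma Mx_comm a b c e : uniq [:: a; b; c; e] -> Mx a b *m Mx c e = Mx c e *m Mx a b.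
Proof.
move=> u4; have D1 := is_mxderive_mul (rho_der0 a b) (is_mxderive_cst (Mx c e) 0).
have D2 := is_mxderive_mul (is_mxderive_cst (Mx c e) 0) (rho_der0 a b).
rewrite mulmx0 addr0 in D1; rewrite mul0mx add0r in D2.
apply: is_mxderive_unique D1 _; move: D2; congr is_mxderive; apply/funext => s.
have -> : rho (expX a b s) *m Mx c e = 1%:C *: Mx c e *m rho (expX a b s).
  by apply: rho_Mx_comm => t; rewrite mul1r expX_comm.
by rewrite scale1r.
Qed.

(* The derivative at [t = 0] of the Euler decomposition. *)
Lemma Mx_rot a b c s : uniq [:: a; b; c] -> 0 < cos s ->
  rho (expX a b s) *m Mx b c =
  ((cos s)%:C *: Mx b c + (sin s)%:C *: Mx a c) *m rho (expX a b s).
Proof.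
move=> u3 cs.
pose al t := atan (sin s * tan t) : R.
pose be t := asin (sin t * cos s) : R.
pose ga t := atan (tan s * (cos t)^-1) : R.
have E t : 0 < cos t -> rho (expX a b s) *m rho (expX b c t) =
    rho (expX a c (al t)) *m rho (expX b c (be t)) *m rho (expX a b (ga t)).
  move=> ct; have e := euler_angles cs ct u3.
  have oXX (g h : G) : (val g *m val h) *m (val g *m val h)^T == 1%:M.
    by rewrite trmx_mul mulmxA -(mulmxA (val g)) (eqP (valP h)) mulmx1; exact: (valP g).
  pose mulG (g h : G) : G := exist _ (val g *m val h) (oXX g h).
  have mulGE g h : rho g *m rho h = rho (mulG g h) by rewrite -(@rhoM g h (mulG g h)).
  by rewrite !mulGE; congr rho; apply: val_inj.
have D1 : is_mxderive (fun t => rho (expX a b s) *m rho (expX b c t)) 0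
    (rho (expX a b s) *m Mx b c).
  have := is_mxderive_mul (is_mxderive_cst (rho (expX a b s)) 0) (rho_der0 b c).
  by rewrite mul0mx add0r.
have c0 : cos (0 : R) != 0 by rewrite cos0 oner_neq0.
have al0 : al 0 = 0 by rewrite /al tan0 mulr0 atan0.
have be0 : be 0 = 0.
  rewrite /be sin0 mul0r -[X in asin X]sin0 sinK // in_itv /= oppr_le0.
  by rewrite divr_ge0 // pi_ge0.
have dal : is_derive (0 : R) (1 : R) al (sin s).
  have d1 : is_derive (0 : R) (1 : R) (fun t => sin s * tan t) (sin s).
    apply: (is_derive_eq (is_derive_mul (is_derive_cst (sin s) (0 : R) (1 : R)) (is_derive_tan c0))).
    by rewrite cos0 mul0r add0r expr1n invr1 mulr1.
  apply: (is_derive_eq (is_derive1_comp (is_derive1_atan _) d1)).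
  by rewrite tan0 mulr0 expr0n addr0 invr1 mul1r.
have dbe : is_derive (0 : R) (1 : R) be (cos s).
  have d1 : is_derive (0 : R) (1 : R) (fun t => sin t * cos s) (cos s).
    apply: (is_derive_eq (is_derive_mul (is_derive_sin 0) (is_derive_cst (cos s) (0 : R) (1 : R)))).
    by rewrite cos0 mul1r mulr0 addr0.
  have r1 : -1 < sin 0 * cos s < 1 by rewrite sin0 mul0r ltr01 andbT ltrN10.
  apply: (is_derive_eq (is_derive1_comp (g := fun t : R => sin t * cos s) (is_derive1_asin r1) d1)).
  by rewrite sin0 mul0r expr0n subr0 sqrtr1 invr1 mul1r.
have dga : is_derive (0 : R) (1 : R) ga 0.
  have d0 : is_derive (0 : R) (1 : R) (fun t => (cos t)^-1) 0.
    apply: (is_derive_eq (is_deriveV c0 (is_derive_cos 0))).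
    by rewrite sin0 oppr0 scaler0.
  have d1 : is_derive (0 : R) (1 : R) (fun t => tan s * (cos t)^-1) 0.
    apply: (is_derive_eq (is_derive_mul (is_derive_cst (tan s) (0 : R) (1 : R)) d0)).
    by rewrite mul0r mulr0 addr0.
  by apply: (is_derive_eq (is_derive1_comp (is_derive1_atan _) d1)); rewrite mulr0.
have D2 : is_mxderive (fun t => rho (expX a c (al t)) *m rho (expX b c (be t)) *m
     rho (expX a b (ga t))) 0
    (((cos s)%:C *: Mx b c + (sin s)%:C *: Mx a c) *m rho (expX a b s)).
  have dA := @is_mxderive_comp R _ _ (fun t => rho (expX a c t)) al 0 _ (Mx a c) dal.
  rewrite al0 in dA; have {}dA := dA (rho_der0 a c).
  have dB := @is_mxderive_comp R _ _ (fun t => rho (expX b c t)) be 0 _ (Mx b c) dbe.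
  rewrite be0 in dB; have {}dB := dB (rho_der0 b c).
  have dC := is_mxderive_comp dga (rho_der a b (ga 0)).
  have := is_mxderive_mul (is_mxderive_mul dA dB) dC.
  rewrite al0 be0 !rho_expX0 !mul1mx !mulmx1 scale0r addr0.
  (* [ga 0 = atan (tan s)] may differ from [s] by a period; instead of comparing the angles, the
     identity at [t = 0] shows that both have the same matrix. *)
  have := E 0; rewrite cos0 => /(_ ltr01); rewrite al0 be0 !rho_expX0 mulmx1 !mul1mx => <-.
  by rewrite addrC.
apply: is_mxderive_unique D1 _; apply: is_mxderive_ext D2.
have : \forall t \near (0 : R), 0 < cos t.
  by apply: (cvgr_gt _ (@continuous_cos R 0)); rewrite cos0.
by apply: filterS => t ct; rewrite E.
Qed.

(** This is the derivative of [Mx_rot] at [s = 0]: cos contributes nothing, sin contributes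
    [Mx a c], and the rotations contribute the two products. *)
Lemma Mx_bracket a b c : uniq [:: a; b; c] ->
  Mx a b *m Mx b c - Mx b c *m Mx a b = Mx a c.
Proof.
move=> u3; apply/eqP; rewrite subr_eq; apply/eqP.
have D1 := is_mxderive_mul (rho_der0 a b) (is_mxderive_cst (Mx b c) 0).
rewrite mulmx0 addr0 in D1.
have dcos : is_mxderive (fun s => (cos s)%:C *: Mx b c + (sin s)%:C *: Mx a c) 0 (Mx a c).
  have d1 := is_mxderive_scale (Mx b c) (is_cderive_real (is_derive_cos (0 : R))).
  have d2 := is_mxderive_scale (Mx a c) (is_cderive_real (is_derive_sin (0 : R))).
  by have := is_mxderive_add d1 d2; rewrite sin0 cos0 oppr0 scale0r scale1r add0r.
have D2 := is_mxderive_mul dcos (rho_der0 a b).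
rewrite /= sin0 cos0 scale1r scale0r addr0 rho_expX0 mulmx1 in D2.
apply: is_mxderive_unique D1 _; apply: is_mxderive_ext D2.
have : \forall t \near (0 : R), 0 < cos t.
  by apply: (cvgr_gt _ (@continuous_cos R 0)); rewrite cos0.
by apply: filterS => s cs; rewrite (Mx_rot u3 cs).
Qed.

(** The conjugate of [V] by the rotation has derivative zero in the angle, so it keeps its value at
    angle 0. *)
Lemma rho_expX_comm a b t (V : 'M[C]_d.+1) :
  V *m Mx a b = Mx a b *m V -> rho (expX a b t) *m V = V *m rho (expX a b t).
Proof.
move=> cV.
have cM s : rho (expX a b s) *m Mx a b = Mx a b *m rho (expX a b s).
  rewrite -[in RHS](scale1r (Mx a b)); apply: rho_Mx_comm => x.
  by rewrite /= mul1r -!expXD addrC.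
pose K s := rho (expX a b s) *m V *m rho (expX a b (- s)).
have dK s : is_mxderive K s 0.
  have ds : is_derive (s : R) (1 : R) (fun x : R => - x) (- 1).
    exact: (is_deriveN (is_derive_id (s : R) (1 : R))).
  have d1 := is_mxderive_comp ds (rho_der a b (- s)).
  have := is_mxderive_mul (is_mxderive_mul (rho_der a b s) (is_mxderive_cst V s)) d1.
  rewrite mulmx0 addr0 rmorphN scaleN1r mulmxN !cM !mulmxA.
  by rewrite -(mulmxA _ V (Mx a b)) cV !mulmxA cM subrr.
have := is_mxderive_0_cst t 0 dK; rewrite /K oppr0 !rho_expX0 mul1mx mulmx1 => KV.
by rewrite -{2}KV -!mulmxA -rho_expXD addNr rho_expX0 mulmx1.
Qed.

Lemma Mx_diag a : Mx a a = 0.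
Proof. by apply: (@alg_2torsion C 'M[C]_d.+1); apply: MxN. Qed.

Lemma Mx_so a b c e : Mx a b * Mx c e - Mx c e * Mx a b =
  (c == b)%:R * Mx a e - (c == a)%:R * Mx b e + (e == b)%:R * Mx c a - (e == a)%:R * Mx c b.
Proof.
apply: so_bracket => [a' b'|a' b' c' e' u4|a' b' c' u3]; first exact: MxN.
  exact: Mx_comm.
exact: Mx_bracket.
Qed.

Lemma O_mul_subproof (g h : G) : (val g *m val h) *m (val g *m val h)^T == 1%:M.
Proof. by rewrite trmx_mul mulmxA -(mulmxA (val g)) (eqP (valP h)) mulmx1; exact: (valP g). Qed.

Definition O_mul (g h : G) : G := exist _ (val g *m val h) (O_mul_subproof g h).

Lemma O_one_subproof : 1%:M *m 1%:M^T == 1%:M :> 'M[R]_n.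
Proof. by rewrite trmx1 mulmx1. Qed.

Definition O_one : G := exist _ 1%:M O_one_subproof.

Definition O_refl c : G := exist _ (refl_mx R c) (introT eqP (refl_mx_orth R c)).

(** Adjacent rotations and reflections generate the group by [orthogonal_ind]. The restriction to
    adjacent planes fits [sum_Pf2_comm], which treats neighbouring indices. *)
Lemma rho_comm (V : 'M[C]_d.+1) :
  (forall a b : 'I_n, b = a.+1 :> nat -> V *m Mx a b = Mx a b *m V) ->
  (forall c, rho (O_refl c) *m V = V *m rho (O_refl c)) ->
  forall g, rho g *m V = V *m rho g.
Proof.
move=> cX cR g.
have mulV h k : rho h *m V = V *m rho h -> rho k *m V = V *m rho k ->
    rho (O_mul h k) *m V = V *m rho (O_mul h k).
  by move=> ch ck; rewrite (@rhoM h k) // -mulmxA ck mulmxA ch mulmxA.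
(* [orthogonal_ind] concerns predicates on matrices while [rho] takes group elements, so the
   predicate asks for a group element with the given matrix. *)
have [h [hg ch]] : exists h : G, val h = val g /\ (rho h *m V = V *m rho h).
  apply: (@orthogonal_ind _ _ (fun M => exists h : G, val h = M /\ (rho h *m V = V *m rho h))).
  - by exists O_one; rewrite rho1 // mul1mx mulmx1.
  - move=> a b t _ ab [h [<- ch]]; exists (O_mul (expX a b t) h); split=> //.
    by apply: mulV => //; apply/rho_expX_comm/cX.
  - by move=> c _ [h [<- ch]]; exists (O_mul (O_refl c) h); split=> //; apply: mulV.
  - exact: (eqP (valP g)).
by have <- : h = g by apply: val_inj.
Qed.

Lemma rho_refl_Mx c a b : rho (O_refl c) * Mx a b =
  ((-1) ^+ (a == c) * (-1) ^+ (b == c)) *: (Mx a b * rho (O_refl c)).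
Proof.
have [->|ab] := eqVneq a b; first by rewrite Mx_diag mulr0 mul0r scaler0.
have := rho_Mx_comm (fun t => refl_expX c t ab : val (O_refl c) *m _ = _).
move=> /= e; rewrite -[LHS]/(rho (O_refl c) *m Mx a b) e -scalemxAl -signr_addb.
by rewrite rmorphXn rmorphN1.
Qed.

Section Invariants.
Variable x0 : 'I_n.
Local Notation Qn k := (sum_Pf2 Mx x0 k (enum 'I_n)).

Lemma rho_sum_Pf2 k g : rho g *m Qn k = Qn k *m rho g.
Proof.
apply: rho_comm => [a b ab|c]; last first.
  apply: (sum_Pf2_conj x0 (e := fun a => (-1) ^+ (a == c)) k (enum 'I_n) (rho_refl_Mx c)) => a.
  exact: sqrr_sign.
apply/esym.
have e : enum 'I_n = take a (enum 'I_n) ++ a :: b :: drop b.+1 (enum 'I_n).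
  rewrite -{1}(cat_take_drop a (enum 'I_n)) (drop_nth a) ?size_enum_ord //.
  rewrite nth_ord_enum -ab (drop_nth b) ?size_enum_ord // nth_ord_enum //.
have := @sum_Pf2_comm C 'M[C]_d.+1 _ Mx x0 Mx_so (fun a b => MxN b a) k a b
  (take a (enum 'I_n)) (drop b.+1 (enum 'I_n)).
by rewrite -e; apply; apply: enum_uniq.
Qed.

Lemma ev_comp k (T : 'I_k -> fn -> fn) (N : 'I_k -> 'M[C]_d.+1) :
  (forall i u, W u -> W (T i u) /\ ev (T i u) = N i *m ev u) ->
  forall u, W u -> W ((\big[comp/idfun]_(i < k) T i) u) /\
   ev ((\big[comp/idfun]_(i < k) T i) u) = (\prod_(i < k) N i) *m ev u.
Proof.
move=> TN; elim/big_rec2: _ => [u Wu|i y1 y2 _ IH u Wu]; first by rewrite mul1mx.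
have [W1 e1] := IH u Wu; have [W2 e2] := TN i _ W1.
by split=> //=; rewrite e2 e1 mulmxA.
Qed.

Lemma W_sum (I : Type) (s : seq I) (Q : pred I) (u : I -> fn) :
  (forall i, Q i -> W (u i)) -> W (\sum_(i <- s | Q i) u i).
Proof.
move=> Wu; have [W0 Wl] := subW; elim: s => [|i s IH]; first by rewrite big_nil; exact: W0.
rewrite big_cons; case: ifP => Qi; last exact: IH.
by rewrite -[u i]scale1r; apply: (Wl _ _ _ (Wu i Qi) IH).
Qed.

Lemma W_scale (c : C) (u : fn) : W u -> W (c *: u).
Proof. by move=> Wu; have [W0 Wl] := subW; rewrite -[_ *: _]addr0; apply: (Wl _ _ _ Wu W0). Qed.

Lemma ev_Pf k (f : 'I_k.*2 -> 'I_n) u : W u ->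
  W (Pf (fun i j => @Xop R n r (f i) (f j)) u) /\
  ev (Pf (fun i j => @Xop R n r (f i) (f j)) u) =
    ((2 ^ k * k`!)%:R^-1 *: pf Mx f) *m ev u.
Proof.
move=> Wu.
have cmp (s : 'S_k.*2) := @ev_comp k
  (fun i => Xop (f (s (fst_pos (leqnn k.*2) i))) (f (s (snd_pos (leqnn k.*2) i))))
  (fun i => Mx (f (s (fst_pos (leqnn k.*2) i))) (f (s (snd_pos (leqnn k.*2) i))))
  (fun i u Wu => conj (@W_Xop _ _ u Wu) (ev_Xop _ _ Wu)) u Wu.
split.
  apply: W_scale; apply: W_sum => s _; apply: W_scale; exact: (cmp s).1.
rewrite /Pf evZ ev_sum (pf_restricted (fun a b => MxN b a)).
set S := \sum_(s | _) (_ * xprod _ _).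
have -> : (2 ^ k * k`!)%:R^-1 *: ((2 ^ k)%:R * S) = (k`!)%:R^-1 *: S.
  have -> : (2 ^ k)%:R * S = (2 ^ k)%:R *: S by rewrite scaler_nat mulr_natl.
  rewrite scalerA natrM invfM mulrAC mulVf ?mul1r //.
rewrite -scalemxAl mulmx_suml; congr (_ *: _); apply: eq_bigr => s _.
rewrite evZ (cmp s).2 scaler_sign mulr_sign; case: (s : bool); last by [].
by rewrite mulNmx.
Qed.

Lemma ev_Vop k u : W u -> W (Vop k u) /\ ev (Vop k u) = ((-1) ^+ k *: Qn k) *m ev u.
Proof.
move=> Wu; split.
  apply: W_scale; apply: W_sum => I _; have [W1 _] := @ev_Pf k (fun i => I i) _ Wu.
  exact: (@ev_Pf k (fun i => I i) _ W1).1.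
rewrite /Vop evZ ev_sum -scalemxAl mulmx_suml; congr (_ *: _).
rewrite -(@sum_increasing _ k.*2 n (fun s => Pfs Mx x0 k s * Pfs Mx x0 k s *m ev u)).
apply: eq_bigr => I _; have [W1 e1] := @ev_Pf k (fun i => I i) _ Wu.
have [_ ->] := @ev_Pf k (fun i => I i) _ W1; rewrite e1 mulmxA.
have -> // : Pfs Mx x0 k (codom I) = (2 ^ k * k`!)%:R^-1 *: pf Mx (fun i => I i).
by rewrite /Pfs; congr (_ *: _); apply: eq_pf => i; rewrite nth_codom_ord.
Qed.

End Invariants.

Definition lie_mx (Y : 'M[C]_n) : 'M[C]_d.+1 :=
  \sum_(a < n) \sum_(b < n | (a < b)%N) Y a b *: Mx a b.

Lemma ev_lie_act Y u : W u -> ev (lie_act Y u) = lie_mx Y *m ev u.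
Proof.
move=> Wu; rewrite /lie_act /lie_mx ev_sum mulmx_suml; apply: eq_bigr => a _.
rewrite ev_sum mulmx_suml; apply: eq_bigr => b _.
by rewrite evZ -scalemxAl ev_Xop.
Qed.

Lemma lie_mxZ c Y : lie_mx (c *: Y) = c *: lie_mx Y.
Proof.
rewrite /lie_mx scaler_sumr; apply: eq_bigr => a _.
by rewrite scaler_sumr; apply: eq_bigr => b _; rewrite mxE scalerA.
Qed.

Lemma lie_mxB Y Z : lie_mx (Y - Z) = lie_mx Y - lie_mx Z.
Proof.
rewrite /lie_mx -sumrB; apply: eq_bigr => a _.
by rewrite -sumrB; apply: eq_bigr => b _; rewrite !mxE scalerBl.
Qed.

Lemma lie_mx_Xmx (a b : 'I_n) : (a < b)%N -> lie_mx (Xmx C a b) = Mx a b.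
Proof.
move=> ab; have E (c e : 'I_n) : (c < e)%N -> Xmx C a b c e = ((c == a) && (e == b))%:R.
  move=> ce; rewrite /Xmx !mxE; have [cb|_] := eqVneq c b; last by rewrite subr0.
  have [ea|_] := eqVneq e a; last by rewrite subr0.
  by move: ce; rewrite cb ea ltnNge ltnW.
rewrite /lie_mx (bigD1 a) //= (bigD1 b) //= E // !eqxx scale1r.
rewrite [X in _ + X + _]big1 => [|e /andP[ae eb]]; last first.
  by rewrite E // (negbTE eb) andbF scale0r.
rewrite addr0 big1 ?addr0 // => c ca; rewrite big1 // => e ce.
by rewrite E // (negbTE ca) scale0r.
Qed.

Section HighestWeightVector.
Local Notation f := (fst_pos (half_double_leq n)).
Local Notation s := (snd_pos (half_double_leq n)).
Variables (la : 'I_n./2 -> int) (v : fn).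
Hypothesis Wv : W v.
Hypothesis hv : highest_weight_vector la v.

Lemma hw_torus j : Mx (f j) (s j) *m ev v = - ('i * (la j)%:~R) *: ev v.
Proof.
have [_ /(_ j)/(congr1 ev) + _] := hv.
rewrite ev_lie_act // evZ /Hmx lie_mxZ lie_mx_Xmx //= -scalemxAl.
move/(congr1 (fun x => - 'i *: x)); rewrite !scalerA mulNr -expr2 sqrCi opprK scale1r => ->.
by rewrite mulNr.
Qed.

(** The claim is that [root_mx R q c] kills [v]. For an index [c] outside all planes it is itself a
    root vector; for [c] in a later plane q' it is a combination of the root vectors for e_q + e_q'
    and e_q - e_q'. *)
Lemma hw_nilpotent (q : 'I_n./2) (c : 'I_n) : (q.+1.*2 <= c)%N ->
  Mx (f q) c *m ev v = 'i *: (Mx (s q) c *m ev v).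
Proof.
move=> qc; pose z (c : 'I_n) := lie_mx (root_mx R q c) *m ev v.
have zE (c' : 'I_n) : (q.+1.*2 <= c')%N ->
    z c' = Mx (f q) c' *m ev v - 'i *: (Mx (s q) c' *m ev v).
  move=> qc'; rewrite /z /root_mx lie_mxB lie_mxZ !lie_mx_Xmx /=; [|lia..].
  by rewrite mulmxBl -scalemxAl.
suff : z c = 0 by rewrite zE // => /eqP; rewrite subr_eq0 => /eqP.
have [_ _ nil] := hv.
have nilM al Y : positive_root al -> root_vector al Y -> lie_mx Y *m ev v = 0.
  move=> pa ra; rewrite -ev_lie_act // (nil al Y pa ra).
  by apply/colP => i; rewrite !mxE.
have [cn|cn] := ltnP c n./2.*2; last first.
  apply: (nilM (fun k => (k == q)%:Z)); last exact: root_vector_single.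
  by apply: Or33; split; [have := ltn_ord c; lia | exists q].
have c2 : (c./2 < n./2)%N by lia.
pose q' : 'I_n./2 := Ordinal c2.
have qq : (q < q')%N by rewrite /=; lia.
have zq (b : bool) : z (f q') - ('i * (-1) ^+ b) *: z (s q') = 0.
  rewrite /z scalemxAl -mulmxBl -lie_mxZ -lie_mxB.
  pose al k : int := (k == q)%:Z + (-1) ^+ b * (k == q')%:Z.
  have rv : root_vector al _ := @root_vector_pair R n q b q' al qq (fun k => erefl _).
  apply: nilM rv; rewrite /al.
  case: b {al}; [apply: Or31|apply: Or32]; exists q, q'; split=> // k.
    by rewrite expr1 mulN1r.
  by rewrite expr0 mul1r.
have [zf zs] := scale_pm_i_eq0 (zq false) (zq true).
have [ce|ce] : c = f q' \/ c = s q'.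
  have [ce|ce] : (c = c./2.*2 :> nat) \/ (c = c./2.*2.+1 :> nat) by lia.
    by left; apply: val_inj.
  by right; apply: val_inj.
  exact: etrans (congr1 z ce) zf.
exact: etrans (congr1 z ce) zs.
Qed.

End HighestWeightVector.

Section Eigenvalue.
Variables (x0 : 'I_n) (hrn : (r.*2 <= n)%N) (m : 'I_r -> int) (v : fn).
Hypothesis Wv : W v.
Hypothesis hv : highest_weight_vector (pad m) v.

Let mm (q : nat) : C := (oapp m 0 (insub q))%:~R.

(* The matrix of [\sum_k c_k V_k] for [z = 2 nu + 1], and its eigenvalue. *)
Definition invariant_mx (z : C) : 'M[C]_d.+1 := \sum_(k < r.+1)
  ((-1) ^+ k * \prod_(k <= j < r) ((j.+1%:R + z) * (j.+1%:R - z - n%:R))) *: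
  sum_Pf2 Mx x0 k (enum 'I_n).

Definition invariant_scalar (z : C) : C :=
  \prod_(q < r) ((z + q.+1%:R - mm q) * (q.+1%:R - mm q - z - n%:R)).

Lemma invariant_mx_hw z :
  invariant_mx z *m ev v = invariant_scalar z *: ev v.
Proof.
pose row1 : 'rV[C]_d.+1 := delta_mx 0 0.
(* [sum_Pf2_eigen] acts on an element of the algebra, so the vector is made the first column of a
   square matrix; multiplication by [row1^T] recovers it at the end. *)
pose V : 'M[C]_d.+1 := ev v *m row1.
have nthE q (lt : (q < n)%N) : nth x0 (enum 'I_n) q = Ordinal lt.
  by apply: val_inj; rewrite /= nth_enum_ord.
have H1 q : (q.*2.+1 < size (enum 'I_n))%N ->
    Mx (nth x0 (enum 'I_n) q.*2) (nth x0 (enum 'I_n) q.*2.+1) * V = - ('i * mm q) *: V.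
  rewrite size_enum_ord => qn; have q2 : (q < n./2)%N by lia.
  rewrite (nthE _ (ltnW qn)) (nthE _ qn) -mulmxE /V mulmxA.
  have := hw_torus Wv hv (Ordinal q2); rewrite /pad /=.
  have -> : fst_pos (half_double_leq n) (Ordinal q2) = Ordinal (ltnW qn) by apply: val_inj.
  have -> : snd_pos (half_double_leq n) (Ordinal q2) = Ordinal qn by apply: val_inj.
  by move=> ->; rewrite -scalemxAl.
have H2 q : (q.*2.+1 < size (enum 'I_n))%N -> {in drop q.+1.*2 (enum 'I_n), forall c,
    Mx (nth x0 (enum 'I_n) q.*2) c * V = 'i *: (Mx (nth x0 (enum 'I_n) q.*2.+1) c * V)}.
  rewrite size_enum_ord => qn c cq; have q2 : (q < n./2)%N by lia.
  have qc : (q.+1.*2 <= c)%N.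
    move/(nthP x0): cq => [ i ]; rewrite size_drop size_enum_ord nth_drop => il <-.
    rewrite nth_enum_ord; lia.
  rewrite (nthE _ (ltnW qn)) (nthE _ qn) -mulmxE /V !mulmxA.
  have := @hw_nilpotent _ _ Wv hv (Ordinal q2) c qc.
  have -> : fst_pos (half_double_leq n) (Ordinal q2) = Ordinal (ltnW qn) by apply: val_inj.
  have -> : snd_pos (half_double_leq n) (Ordinal q2) = Ordinal qn by apply: val_inj.
  by move=> ->; rewrite -scalemxAl.
have i2 : 'i * 'i = -1 :> C by rewrite -expr2 sqrCi.
have mm0 q : (r <= q)%N -> mm q = 0.
  by move=> rq; rewrite /mm insubF // ltnNge rq.
have rn : (r.*2 <= size (enum 'I_n))%N by rewrite size_enum_ord.
have := sum_Pf2_eigen Mx_so (fun a b => MxN b a) i2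
  (enum_uniq 'I_n) mm0 rn H1 H2 z.
rewrite size_enum_ord -mulmxE /V mulmxA => /(congr1 (fun M => M *m row1^T)).
rewrite scalemxAl -!mulmxA.
have -> : row1 *m row1^T = 1%:M.
  by rewrite trmx_delta mul_delta_mx; apply/matrixP => i j; rewrite !mxE !ord1.
by rewrite !mulmx1.
Qed.

Hypothesis irrW : Defs.irreducible [set: G] W.

Lemma rho_invariant_mx z g : rho g *m invariant_mx z = invariant_mx z *m rho g.
Proof.
rewrite /invariant_mx mulmx_sumr mulmx_suml; apply: eq_bigr => k _.
by rewrite -scalemxAr -scalemxAl rho_sum_Pf2.
Qed.

(* The eigenspace through the highest weight vector is invariant, hence all of
   the irreducible space [W]. *)
Lemma invariant_mx_scalar z u : W u ->
  invariant_mx z *m ev u = invariant_scalar z *: ev u.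
Proof.
pose W' : set fn := [set u | W u /\ invariant_mx z *m ev u = invariant_scalar z *: ev u].
have [[W0 Wl] _ _ Wmin] := irrW.
suff -> : W = W' by case.
have subW' : W' `<=` W by move=> x [].
have ev0 : ev 0 = 0 by apply/colP => i; rewrite !mxE.
case: (Wmin W' subW') => [||W'0|->] //.
- split=> [|a x y [Wx ex] [Wy ey]]; first by split=> //; rewrite ev0 mulmx0 scaler0.
  split; first exact: Wl.
  by rewrite ev_linear mulmxDr -scalemxAr ex ey scalerDr !scalerA mulrC.
- move=> g x _ [Wx ex]; split; first exact: invW.
  by rewrite ev_O // mulmxA -rho_invariant_mx -mulmxA ex -scalemxAr.
have : W' v by split=> //; apply: invariant_mx_hw.
by rewrite W'0 /= => v0; case: hv.
Qed.

Lemma sum_Vop_eigen nu u : W u ->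
  \sum_(k < r.+1) ck n r nu k *: Vop k u = invariant_scalar (2 * nu + 1) *: u.
Proof.
move=> Wu; have VW k := ev_Vop x0 k Wu.
apply: ev_inj.
- by apply: (subspace_sum subW) => k; apply: (VW k).1.
- exact: W_scale.
rewrite ev_sum evZ -invariant_mx_scalar // /invariant_mx mulmx_suml.
apply: eq_bigr => k _; rewrite evZ (VW k).2 -!scalemxAl scalerA; congr (_ *: _).
rewrite mulrC; congr (_ * _); rewrite /ck big_add1.
by apply: eq_bigr => j _; apply: ck_factor.
Qed.

End Eigenvalue.

End Representation.

(** * Expansions *)

Section Expansions.
Variables (R : realType) (n r : nat).
Local Notation C := R[i].
Local Notation Gr := (Gr R n r).
Local Notation fn := (fn R n r).

Definition Dhat_op (nu : C) (f : fn) : fn :=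
  (- (1 / 4)) ^+ r *: \sum_(k < r.+1) ck n r nu k *: Vop k f.

Lemma Dhat_scalarE nu (m : 'I_r -> int) :
  Dhat_scalar n nu m = (- (1 / 4)) ^+ r * @invariant_scalar R n r m (2 * nu + 1).
Proof.
rewrite -{2}[r]card_ord -prodr_const -big_split; apply: eq_bigr => q _ /=.
rewrite valK /=; exact: Dhat_factor.
Qed.

Lemma Hm_smooth (m : 'I_r -> int) (u : fn) : Hm m u -> smooth u.
Proof. by move=> [W [_ smW _ _] Wu]; apply: smW. Qed.

Lemma Dhat_op_Hm (hr : (1 <= r)%N) (hrn : (r.*2 <= n)%N) nu (m : 'I_r -> int) (u : fn) :
  Hm m u -> Dhat_op nu u = Dhat_scalar n nu m *: u.
Proof.
move=> [W [fdW smW irrW [U UW [_ [v Uv hv]]]] Wu].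
have [subW invW _ _] := irrW.
have inv g x : W x -> W (O_act g x) by apply: invW.
have [d [p [w [Ww wp Wspan]]]] := findim_dual_basis subW fdW.
have n0 : (0 < n)%N by apply: leq_trans hrn; rewrite double_gt0.
(* In dimension 0 the highest weight vector would vanish. Positive dimension makes the square
   matrices a nontrivial ring, as the algebra above requires. *)
case: d p w Ww wp Wspan => [|d] p w Ww wp Wspan.
  have [v0 _ _] := hv; case: v0; rewrite (Wspan v (UW v Uv)).
  exact: big_ord0.
rewrite /Dhat_op (sum_Vop_eigen subW inv smW Ww wp Wspan (Ordinal n0) hrn (UW v Uv) hv irrW nu Wu).
by rewrite scalerA -Dhat_scalarE.
Qed.

(** [cvg_smooth] controls every word in the [Xop], hence every finite combination of words. The
    identity is restricted to smooth functions because the linearity of [Xop] relies on the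
    existence of derivatives. *)
Definition diff_op (T : fn -> fn) := exists L : seq (C * seq ('I_n * 'I_n)),
  forall f, smooth f -> T f = \sum_(cw <- L) cw.1 *: Xword cw.2 f.

Lemma diff_op_id : diff_op id.
Proof. by exists [:: (1, [::])] => f _; rewrite big_seq1 scale1r. Qed.

Lemma diff_op_Xop a b : diff_op (Xop a b).
Proof. by exists [:: (1, [:: (a, b)])] => f _; rewrite big_seq1 scale1r. Qed.

Lemma diff_op_scale (c : C) T : diff_op T -> diff_op (fun f => c *: T f).
Proof.
move=> [L e]; exists [seq (c * cw.1, cw.2) | cw <- L] => f sf.
by rewrite big_map (e f sf) scaler_sumr; apply: eq_bigr => cw _; rewrite scalerA.
Qed.

Lemma diff_op_sum (I : Type) (s : seq I) (P : pred I) (T : I -> fn -> fn) :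
  (forall i, diff_op (T i)) -> diff_op (fun f => \sum_(i <- s | P i) T i f).
Proof.
move=> dT; elim: s => [|i s [L e]].
  by exists [::] => f _; rewrite !big_nil.
have [L' e'] := dT i.
exists ((if P i then L' else [::]) ++ L) => f sf; rewrite big_cons big_cat -(e f sf).
case: (P i); first by rewrite (e' f sf).
by rewrite big_nil [RHS]add0r.
Qed.

Lemma Xword_sum w (I : Type) (s : seq I) (c : I -> C) (u : I -> fn) :
  (forall i, smooth (u i)) ->
  Xword w (\sum_(i <- s) c i *: u i) = \sum_(i <- s) c i *: Xword w (u i).
Proof.
move=> su; elim: s => [|i s IH].
  rewrite !big_nil; elim: w => [//|[a b] w IH]; rewrite Xword_cons IH; exact: Xop0.
rewrite !big_cons -IH; apply: Xword_linear; first exact: su.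
by apply: smooth_sum => j _; apply/smoothZ/su.
Qed.

Lemma diff_op_comp S T : diff_op S -> diff_op T -> diff_op (fun f => S (T f)).
Proof.
move=> [L1 e1] [L2 e2].
exists [seq (c1.1 * c2.1, c1.2 ++ c2.2) | c1 <- L1, c2 <- L2] => f sf.
have sT : smooth (T f).
  by rewrite (e2 f sf); apply: smooth_sum => cw _; apply/smoothZ/smooth_Xword.
rewrite (e1 _ sT) big_allpairs_dep; apply: eq_bigr => c1 _.
rewrite (e2 f sf) Xword_sum => [|c2]; last exact: smooth_Xword.
rewrite scaler_sumr; apply: eq_bigr => c2 _.
by rewrite scalerA /Xword foldr_cat.
Qed.

Lemma diff_op_bigcomp k (T : 'I_k -> fn -> fn) :
  (forall i, diff_op (T i)) -> diff_op (\big[comp/idfun]_(i < k) T i).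
Proof.
move=> dT; elim/big_ind: _ => [|S S' dS dS'|i _]; [exact: diff_op_id| |exact: dT].
exact: diff_op_comp.
Qed.

Lemma diff_op_Pf k (f : 'I_k.*2 -> 'I_n) :
  diff_op (Pf (fun i j => @Xop R n r (f i) (f j))).
Proof.
apply/diff_op_scale/diff_op_sum => s; apply/diff_op_scale/diff_op_bigcomp => i.
exact: diff_op_Xop.
Qed.

Lemma diff_op_Vop k : diff_op (@Vop R n r k).
Proof.
apply/diff_op_scale/diff_op_sum => I.
exact: diff_op_comp (diff_op_Pf (fun i => I i)) (diff_op_Pf (fun i => I i)).
Qed.

Lemma diff_op_Dhat_op nu : diff_op (Dhat_op nu).
Proof. by apply/diff_op_scale/diff_op_sum => k; apply/diff_op_scale/diff_op_Vop. Qed.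

Lemma diff_op_smooth T f : diff_op T -> smooth f -> smooth (T f).
Proof.
by move=> [L e] sf; rewrite (e f sf); apply: smooth_sum => cw _; apply/smoothZ/smooth_Xword.
Qed.

Lemma diff_op_linear_sum T N (u : 'I_N -> fn) : diff_op T -> (forall i, smooth (u i)) ->
  T (\sum_(i < N) u i) = \sum_(i < N) T (u i).
Proof.
move=> [L e] su.
have -> : \sum_(i < N) u i = \sum_(i < N) (1 : C) *: u i.
  by apply: eq_bigr => i _; rewrite scale1r.
rewrite e; last by apply: smooth_sum => i _; apply/smoothZ/su.
under eq_bigr do rewrite Xword_sum // scaler_sumr.
rewrite exchange_big; apply: eq_bigr => i _; rewrite (e _ (su i)).
by apply: eq_bigr => cw _; rewrite scale1r.
Qed.

Lemma cvg_diff_op T (F : nat -> fn) f : diff_op T -> (forall N, smooth (F N)) ->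
  cvg_smooth F f -> cvg_smooth (fun N => T (F N)) (T f).
Proof.
move=> dT sF [sf cF]; split; first exact: diff_op_smooth.
move=> w e e0; have [L TE] := dT.
suff H : forall e, 0 < e -> \forall N \near \oo, forall P : Gr,
  `|\sum_(cw <- L) cw.1 * (Xword (w ++ cw.2) (F N) P - Xword (w ++ cw.2) f P)| <= e%:C.
  apply: filterS (H e e0) => N HN P; move: (HN P); congr (`|_| <= _).
  rewrite (TE _ (sF N)) (TE _ sf) !Xword_sum => [|cw|cw]; [|exact: smooth_Xword..].
  rewrite !sum_fnE -sumrB; apply: eq_bigr => cw _.
  by rewrite mulrBr /Xword !foldr_cat.
elim: L {TE} => [|[c w'] L IH] {}e {}e0.
  by near=> N => P; rewrite big_nil normr0 lecR ltW.
(* Adding 1 keeps the divisor positive when the coefficient is 0. *)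
have c0 : 0 < complex.Re `|c| + 1.
  by rewrite ltr_wpDl //; case: (c) => x y /=; rewrite sqrtr_ge0.
have e2 : 0 < e / 2 by rewrite divr_gt0.
have H1 := cF (w ++ w') _ (divr_gt0 e2 c0).
have H2 := IH _ e2.
near=> N => P.
rewrite big_cons; apply: le_trans (ler_normD _ _) _.
have -> : e%:C = (e / 2)%:C + (e / 2)%:C by rewrite -rmorphD /= -splitr.
apply: lerD; last by move: P; near: N.
have h : `|Xword (w ++ w') (F N) P - Xword (w ++ w') f P| <= (e / 2 / (complex.Re `|c| + 1))%:C.
  by move: P; near: N.
rewrite normrM; apply: le_trans (ler_wpM2l (normr_ge0 _) h) _.
have -> : `|c| = (complex.Re `|c|)%:C by case: (c) => x y; rewrite normc_def.
rewrite -rmorphM lecR; move: (complex.Re _) c0 => k c0.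
rewrite mulrCA -[leRHS]mulr1; apply: ler_wpM2l; first exact: ltW.
by rewrite ler_pdivrMr // mul1r lerDl ler01.
Unshelve. all: by end_near. Qed.

Lemma cvg_smooth_unique (F : nat -> fn) f g : cvg_smooth F f -> cvg_smooth F g -> f = g.
Proof.
move=> [_ cf] [_ cg]; apply/funext => P; apply/eqP; rewrite -subr_eq0 -normr_le0.
have -> : `|f P - g P| = (complex.Re `|f P - g P|)%:C.
  by case: (f P - g P) => x y; rewrite normc_def.
rewrite lecR; apply/ler_addgt0Pl => e e0; rewrite addr0.
have e2 : 0 < e / 2 by rewrite divr_gt0.
(* The empty word turns [cvg_smooth] into uniform convergence of the functions themselves. *)
have [N [hf hg]] := filter_ex (filterI (cf [::] _ e2) (cg [::] _ e2)).
rewrite -lecR.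
have -> : (complex.Re `|f P - g P|)%:C = `|f P - g P|.
  by case: (f P - g P) => x y; rewrite normc_def.
have -> : f P - g P = (F N P - g P) - (F N P - f P) by rewrite opprB [RHS]addrC addrA addrNK.
apply: le_trans (ler_normB _ _) _.
have -> : e%:C = (e / 2)%:C + (e / 2)%:C by rewrite -rmorphD /= -splitr.
by apply: lerD; [apply: hg|apply: hf].
Qed.

End Expansions.

Theorem theorem6p9 (R : realType) (n r : nat) (nu : R[i])
    (hr : (1 <= r)%N) (hrn : (r.*2 <= n)%N) (f g : fn R n r) :
  expandable f ->
  Dhat nu f g <->
  g = (- (1 / 4)) ^+ r *: \sum_(k < r.+1) ck n r nu k *: Vop k f.
Proof.
move=> exf.
have cvgD m u : expansion m u f ->
    cvg_smooth (fun N => \sum_(i < N) Dhat_scalar n nu (m i) *: u i) (Dhat_op nu f).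
  move=> [Hu cu]; have su i := Hm_smooth (Hu i).2.
  have sS N : smooth (\sum_(i < N) u i) by apply: smooth_sum => i _; apply: su.
  have := cvg_diff_op (diff_op_Dhat_op n r nu) sS cu.
  congr cvg_smooth; apply/funext => N.
  rewrite (diff_op_linear_sum (diff_op_Dhat_op n r nu)) //.
  by apply: eq_bigr => i _; apply: (Dhat_op_Hm hr hrn nu (Hu i).2).
(* [Dhat] may choose any expansion of [f]: by [cvgD] the transformed series of each one converges to
   [Dhat_op nu f]. Uniqueness of limits gives one direction, and any expansion provided by [exf]
   gives the other. *)
split=> [[m [u [e cg]]]|->].
  exact: cvg_smooth_unique cg (cvgD m u e).
by have [m [u e]] := exf; exists m, u; split=> //; apply: cvgD.
Qed.
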